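(* Let $n\ge 1$ and let $(\mathscr C,\mathbb E,\mathfrak s)$ be a Frobenius $n$-exangulated category with stable category $\overline{\mathscr C}=\mathscr C/\mathcal I$. Let $S\colon\overline{\mathscr C}\to\overline{\mathscr C}$ be the functor obtained by fixing distinguished $\mathcal I(X)$-exangles, and let $\square_{\overline{\mathfrak s}}$ be the class of $(n+2)$-$S$-sequences in $\overline{\mathscr C}$. Then $(\overline{\mathscr C},S,\square_{\overline{\mathfrak s}})$ is an $(n+2)$-angulated category.
   Context: **$n$-exangulated categories.** Let $n\ge 1$ be an integer, $\mathscr C$ an additive category and $\mathbb E\colon\mathscr C^{\mathrm{op}}\times\mathscr C\to\mathrm{Ab}$ an additive bifunctor. An element $\delta\in\mathbb E(C,A)$ is called an extension; for $a\colon A\to A'$ and $c\colon C'\to C$ write $a_*\delta=\mathbb E(C,a)(\delta)$ and $c^*\delta=\mathbb E(c,A)(\delta)$. Consider complexes $X^\bullet\colon X_0\xrightarrow{d^X_0}X_1\to\cdots\to X_n\xrightarrow{d^X_n}X_{n+1}$ in $\mathscr C$. Two such complexes $X^\bullet,Y^\bullet$ with the same end terms $A$ (degree $0$) and $C$ (degree $n+1$) are homotopy equivalent if there are chain maps $X^\bullet\to Y^\bullet$ and $Y^\bullet\to X^\bullet$ that are identities in degrees $0$ and $n+1$ and whose two composites are chain homotopic to the identities; $[X^\bullet]$ denotes the resulting class. An $n$-exangle $\langle X^\bullet,\delta\rangle$ is such a complex with $\delta\in\mathbb E(X_{n+1},X_0)$ satisfying $(d^X_0)_*\delta=0$, $(d^X_n)^*\delta=0$,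 and such that for every object $W$ the sequences $\mathscr C(W,X_0)\to\cdots\to\mathscr C(W,X_{n+1})\to\mathbb E(W,X_0)$ (last map $f\mapsto f^*\delta$) and $\mathscr C(X_{n+1},W)\to\cdots\to\mathscr C(X_0,W)\to\mathbb E(X_{n+1},W)$ (last map $g\mapsto g_*\delta$) are exact. A morphism of $n$-exangles $\langle X^\bullet,\delta\rangle\to\langle Y^\bullet,\rho\rangle$ is a chain map $f^\bullet$ with $(f_0)_*\delta=(f_{n+1})^*\rho$. An exact realization $\mathfrak s$ of $\mathbb E$ assigns to each $\delta\in\mathbb E(C,A)$ a class $\mathfrak s(\delta)=[X^\bullet]$ with $X_0=A$, $X_{n+1}=C$ such that: (R0) if $\mathfrak s(\delta)=[X^\bullet]$, $\mathfrak s(\rho)=[Y^\bullet]$ and $a_*\delta=c^*\rho$, there is a chain map $(a,f_1,\dots,f_n,c)\colon X^\bullet\to Y^\bullet$ (a lift of $(a,c)$); (R1) if $\mathfrak s(\delta)=[X^\bullet]$ then $\langle X^\bullet,\delta\rangle$ is an $n$-exangle; (R2) $\mathfrak s(0)=[A\xrightarrow{\mathrm{id}}A\to0\to\cdots\to0]$ for $0\in\mathbb E(0,A)$ and $\mathfrak s(0)=[0\to\cdots\to0\to A\xrightarrow{\mathrm{id}}A]$ for $0\in\mathbb E(A,0)$. If $\mathfrak s(\delta)=[X^\bullet]$, then $\langle X^\bullet,\delta\rangle$ is called a distinguished $n$-exangle, written $X_0\to X_1\to\cdots\to X_{n+1}\overset{\delta}{\dashrightarrow}$; $d^X_0$ is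 called an inflation and $d^X_n$ a deflation. $(\mathscr C,\mathbb E,\mathfrak s)$ is $n$-exangulated if $\mathfrak s$ is an exact realization of $\mathbb E$ and: (EA1) inflations are closed under composition and deflations are closed under composition; (EA2) for $\rho\in\mathbb E(D,A)$, $c\colon C\to D$ and distinguished $\langle X^\bullet,c^*\rho\rangle$, $\langle Y^\bullet,\rho\rangle$, the pair $(\mathrm{id}_A,c)$ has a lift $f^\bullet$ whose mapping cone $X_1\to X_2\oplus Y_1\to\cdots\to X_{n+1}\oplus Y_n\to Y_{n+1}$, with differentials $\begin{bmatrix}-d^X_1\\ f_1\end{bmatrix}$, $\begin{bmatrix}-d^X_{i+1}&0\\ f_{i+1}&d^Y_i\end{bmatrix}$ ($1\le i\le n-1$), $\begin{bmatrix}f_{n+1}&d^Y_n\end{bmatrix}$, is distinguished with extension $(d^X_0)_*\rho$; (EA2$^{\mathrm{op}}$) the dual of (EA2). **Frobenius.** An object $P$ is projective if for every distinguished $n$-exangle $A_0\to\cdots\to A_n\xrightarrow{\alpha_n}A_{n+1}\overset{\delta}{\dashrightarrow}$ every morphism $P\to A_{n+1}$ factors through $\alpha_n$; injective objects are defined dually. $\mathcal P$, $\mathcal I$ denote the full subcategories of projectives and injectives. $\mathscr C$ has enough projectives if each $C$ admits a distinguished $n$-exangle $B\to P_1\to\cdots\to P_n\to C\dashrightarrow$ with all $P_i\in\mathcal P$; enough injectives is dual. $\mathscr C$ is Frobenius if it has enough projectives and enough injectives and $\mathcal P=\mathcal I$. **Stable category and $S$.** $\overline{\mathscr C}=\mathscr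 C/\mathcal I$ has the objects of $\mathscr C$ and morphism groups $\mathscr C(A,B)$ modulo morphisms factoring through objects of $\mathcal I$; $\overline f$ is the class of $f$. A left $\mathcal I$-approximation of $X$ is a morphism $X\to I$, $I\in\mathcal I$, through which every morphism from $X$ to an object of $\mathcal I$ factors; right approximations are dual. A distinguished $\mathcal I(X)$-exangle is a distinguished $n$-exangle $X\xrightarrow{i_0^X}I_1^X\to\cdots\to I_n^X\xrightarrow{i_n^X}SX\overset{\delta^X}{\dashrightarrow}$ with all $I_k^X\in\mathcal I$, $i_0^X$ a left $\mathcal I$-approximation of $X$ and $i_n^X$ a right $\mathcal I$-approximation of $SX$; every object has one. Fix one for each $X$. For $f\colon X\to Y$ there is a morphism $Sf\colon SX\to SY$ with $f_*\delta^X=(Sf)^*\delta^Y$, unique in $\overline{\mathscr C}$; this defines the functor $S\colon\overline{\mathscr C}\to\overline{\mathscr C}$, $X\mapsto SX$, $\overline f\mapsto\overline{Sf}$. **$(n+2)$-$S$-sequences.** $\mathbb E$ induces a bifunctor $\overline{\mathbb E}$ on $\overline{\mathscr C}$ by $\overline{\mathbb E}(C,A)=\mathbb E(C,A)$, $\overline{\mathbb E}(\overline c,\overline a)=\mathbb E(c,a)$. For $\delta\in\mathbb E(C,A)$ with $\mathfrak s(\delta)=[X^\bullet]$, $\overline{\mathfrak s}(\delta)$ is the homotopy equivalence class in $\overline{\mathscr C}$ of the image $A\xrightarrow{\overline{d_0^X}}X_1\to\cdots\to X_n\xrightarrow{\overline{d_n^X}}C$. There are natural bijections $\overline{\mathscr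 C}(C,SA)\to\mathbb E(C,A)$, $\overline h\mapsto h^*\delta^A$. An $(n+2)$-$S$-sequence is a sequence $A\to X_1\to\cdots\to X_n\to C\xrightarrow{\overline h}SA$ in $\overline{\mathscr C}$ such that $A\to X_1\to\cdots\to X_n\to C$ represents $\overline{\mathfrak s}(h^*\delta^A)$. **$(n+2)$-angulated categories** (Geiss–Keller–Oppermann). A triple $(\mathcal T,\Sigma,\square)$, with $\mathcal T$ additive, $\Sigma$ an autoequivalence, and $\square$ a class of sequences $X_0\xrightarrow{\alpha_0}X_1\to\cdots\to X_{n+1}\xrightarrow{\alpha_{n+1}}\Sigma X_0$ (called $(n+2)$-angles), such that: (F1) $\square$ is closed under isomorphisms, direct sums and direct summands; $X\xrightarrow{\mathrm{id}}X\to0\to\cdots\to0\to\Sigma X$ is in $\square$ for each $X$; each morphism is the first morphism $\alpha_0$ of some sequence in $\square$; (F2) a sequence $X_0\xrightarrow{\alpha_0}X_1\to\cdots\to X_{n+1}\xrightarrow{\alpha_{n+1}}\Sigma X_0$ is in $\square$ iff $X_1\xrightarrow{\alpha_1}X_2\to\cdots\to X_{n+1}\xrightarrow{\alpha_{n+1}}\Sigma X_0\xrightarrow{(-1)^n\Sigma\alpha_0}\Sigma X_1$ is; (F3) a commutative square on the first morphisms of two sequences in $\square$ extends to a morphism of sequences $(\varphi_0,\dots,\varphi_{n+1},\Sigma\varphi_0)$; (F4) in (F3) the extension can be chosen so that its mapping cone is in $\square$. *)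

(* Defs.v *)
From HB Require Import structures.
From mathcomp Require Import all_boot generic_quotient.
From mathcomp Require Import ssralg ssrint ring_quotient.
From mathcomp Require Import boolp classical_sets.

Set Implicit Arguments.
Unset Strict Implicit.
Unset Printing Implicit Defensive.

Import GRing.Theory.
Local Open Scope ring_scope.
Local Open Scope quotient_scope.

(* The binary biproducts and the zero object are chosen as part of the data.
   Requiring the morphism groups to be zmodTypes, hence choiceTypes, is no
   restriction classically. *)
Record additiveCat := AdditiveCat {
  ob :> Type;
  hom : ob -> ob -> zmodType;
  idm : forall A, hom A A;
  compose : forall A B C, hom B C -> hom A B -> hom A C;
  comp1m : forall A B (f : hom A B), compose (idm B) f = f;
  compm1 : forall A B (f : hom A B), compose f (idm A) = f;
  compA : forall A B C D (h : hom C D) (g : hom B C) (f : hom A B),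
    compose h (compose g f) = compose (compose h g) f;
  compDl : forall A B C (g g' : hom B C) (f : hom A B),
    compose (g + g') f = compose g f + compose g' f;
  compDr : forall A B C (g : hom B C) (f f' : hom A B),
    compose g (f + f') = compose g f + compose g f';
  zob : ob;
  to_zob : forall A (f : hom A zob), f = 0;
  from_zob : forall A (f : hom zob A), f = 0;
  bip : ob -> ob -> ob;
  in1 : forall A B, hom A (bip A B);
  in2 : forall A B, hom B (bip A B);
  pr1 : forall A B, hom (bip A B) A;
  pr2 : forall A B, hom (bip A B) B;
  pr1_in1 : forall A B, compose (pr1 A B) (in1 A B) = idm A;
  pr2_in2 : forall A B, compose (pr2 A B) (in2 A B) = idm B;
  pr1_in2 : forall A B, compose (pr1 A B) (in2 A B) = 0;
  pr2_in1 : forall A B, compose (pr2 A B) (in1 A B) = 0;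
  bipE : forall A B,
    compose (in1 A B) (pr1 A B) + compose (in2 A B) (pr2 A B) = idm (bip A B)
}.

Arguments hom {_} _ _.
Arguments idm {_} _.
Arguments compose {_ _ _ _} _ _.
Arguments zob {_}.
Arguments bip {_} _ _.
Arguments in1 {_ _ _}.
Arguments in2 {_ _ _}.
Arguments pr1 {_ _ _}.
Arguments pr2 {_ _ _}.

Notation "g ∘ f" := (compose g f) (at level 40, left associativity).
Notation "A ⊕ B" := (bip A B) (at level 50, left associativity).

Section Blocks.
Variable T : additiveCat.
Implicit Types A B C D : T.

(* [f ; g] (column), [f , g] (row) and [a , b ; c , d]. *)
Definition colm A C D (f : hom A C) (g : hom A D) : hom A (C ⊕ D) :=
  in1 ∘ f + in2 ∘ g.

Definition rowm A B C (f : hom A C) (g : hom B C) : hom (A ⊕ B) C :=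
  f ∘ pr1 + g ∘ pr2.

Definition blockm A B C D (a : hom A C) (b : hom B C) (c : hom A D)
  (d : hom B D) : hom (A ⊕ B) (C ⊕ D) := colm (rowm a b) (rowm c d).

Lemma comp0m A B C (f : hom A B) : (0 : hom B C) ∘ f = 0.
Proof. by apply: (addrI (0 ∘ f)); rewrite -compDl !addr0. Qed.

Lemma compm0 A B C (g : hom B C) : g ∘ (0 : hom A B) = 0.
Proof. by apply: (addrI (g ∘ 0)); rewrite -compDr !addr0. Qed.

Lemma compNl A B C (g : hom B C) (f : hom A B) : (- g) ∘ f = - (g ∘ f).
Proof. by apply: (addrI (g ∘ f)); rewrite -compDl !subrr comp0m. Qed.

Lemma compNr A B C (g : hom B C) (f : hom A B) : g ∘ (- f) = - (g ∘ f).
Proof. by apply: (addrI (g ∘ f)); rewrite -compDr !subrr compm0. Qed.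

Lemma compBl A B C (g g' : hom B C) (f : hom A B) :
  (g - g') ∘ f = g ∘ f - g' ∘ f.
Proof. by rewrite compDl compNl. Qed.

Lemma compBr A B C (g : hom B C) (f f' : hom A B) :
  g ∘ (f - f') = g ∘ f - g ∘ f'.
Proof. by rewrite compDr compNr. Qed.

End Blocks.

Record functorData (T T' : additiveCat) := FunctorData {
  fob :> T -> T';
  fmap : forall A B : T, hom A B -> hom (fob A) (fob B)
}.

Arguments fmap {_ _} _ {_ _} _.

Definition is_functor (T T' : additiveCat) (F : functorData T T') : Prop :=
  (forall A : T, fmap F (idm A) = idm (F A)) /\
  (forall (A B C : T) (g : hom B C) (f : hom A B),
     fmap F (g ∘ f) = fmap F g ∘ fmap F f).

Definition functor_id (T : additiveCat) : functorData T T :=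
  FunctorData (fun (A B : T) (f : hom A B) => f).

Definition functor_comp (T T' T'' : additiveCat) (G : functorData T' T'')
  (F : functorData T T') : functorData T T'' :=
  FunctorData (fun (A B : T) (f : hom A B) => fmap G (fmap F f)).

Definition naturally_isomorphic (T T' : additiveCat) (F G : functorData T T') :
    Prop :=
  exists (u : forall A, hom (F A) (G A)) (v : forall A, hom (G A) (F A)),
    [/\ forall A, v A ∘ u A = idm (F A),
        forall A, u A ∘ v A = idm (G A)
      & forall (A B : T) (f : hom A B), u B ∘ fmap F f = fmap G f ∘ u A].

Definition is_autoequivalence (T : additiveCat) (F : functorData T T) : Prop :=
  is_functor F /\
  exists G : functorData T T,
    [/\ is_functor G,
        naturally_isomorphic (functor_comp G F) (functor_id T)
      & naturally_isomorphic (functor_comp F G) (functor_id T)].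

Record step (T : additiveCat) (A : T) (P : T -> Type) := Step {
  obj : T;
  arr : hom A obj;
  tail : P obj
}.

Arguments Step {_ _ _} _ _ _.
Arguments obj {_ _ _} _.
Arguments arr {_ _ _} _.
Arguments tail {_ _ _} _.

(* [chain m A B] is the type of sequences A -> X_1 -> ... -> X_m -> B.  The
   recursion on m makes both end terms definitionally equal to A and B. *)
Fixpoint chain (T : additiveCat) (m : nat) (A B : T) : Type :=
  match m with
  | 0%N => hom A B
  | m'.+1 => step A (fun X => chain m' X B)
  end.

Section Chains.
Variable T : additiveCat.
Implicit Types A B C D : T.

(* The first arrow is [first_arr X : hom A (target X)], the last one is
   [last_arr X : hom (source X) B]. *)
Definition target m A B : chain m A B -> T :=
  match m with
  | 0%N => fun _ => B
  | _.+1 => fun X => obj X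
  end.

Definition first_arr m A B : forall X : chain m A B, hom A (target X) :=
  match m with
  | 0%N => fun X => X
  | _.+1 => fun X => arr X
  end.

Fixpoint source m A B : chain m A B -> T :=
  match m with
  | 0%N => fun _ => A
  | m'.+1 => fun X => source (tail X)
  end.

Fixpoint last_arr m A B : forall X : chain m A B, hom (source X) B :=
  match m with
  | 0%N => fun X => X
  | m'.+1 => fun X => last_arr (tail X)
  end.

(* The first (resp. last) arrow of X is f.  These are inductive families because
   the codomain (resp. domain) of the arrow depends on X. *)
Inductive is_first m A C (X : chain m A C) : forall B, hom A B -> Prop :=
  IsFirst : is_first X (first_arr X).

Inductive is_last m A C (X : chain m A C) : forall B, hom B C -> Prop :=
  IsLast : is_last X (last_arr X).

Fixpoint snoc m A B C : chain m A B -> hom B C -> chain m.+1 A C :=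
  match m with
  | 0%N => fun X h => Step B X h
  | m'.+1 => fun X h => Step (obj X) (arr X) (snoc (tail X) h)
  end.

Fixpoint all_mid (P : T -> Prop) m A B : chain m A B -> Prop :=
  match m with
  | 0%N => fun _ => True
  | m'.+1 => fun X => P (obj X) /\ all_mid P (tail X)
  end.

Fixpoint is_complex m A B : chain m A B -> Prop :=
  match m with
  | 0%N => fun _ => True
  | m'.+1 => fun X => first_arr (tail X) ∘ arr X = 0 /\ is_complex (tail X)
  end.

(* Only the components f_1, ..., f_m of a morphism (a, f_1, ..., f_m, b); the end
   components are separate arguments throughout. *)
Fixpoint cmap m A B A' B' : chain m A B -> chain m A' B' -> Type :=
  match m with
  | 0%N => fun _ _ => unit
  | m'.+1 => fun X Y => (hom (obj X) (obj Y) * cmap (tail X) (tail Y))%type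
  end.

Fixpoint is_cmap m A B A' B' : forall (X : chain m A B) (Y : chain m A' B'),
    hom A A' -> cmap X Y -> hom B B' -> Prop :=
  match m with
  | 0%N => fun X Y a _ b => b ∘ X = Y ∘ a
  | m'.+1 => fun X Y a f b =>
      f.1 ∘ arr X = arr Y ∘ a /\ is_cmap f.1 f.2 b
  end.

Fixpoint cmap_id m A B : forall X : chain m A B, cmap X X :=
  match m with
  | 0%N => fun _ => tt
  | m'.+1 => fun X => (idm (obj X), cmap_id (tail X))
  end.

Fixpoint cmap_comp m A B A' B' A'' B'' :
    forall (X : chain m A B) (Y : chain m A' B') (Z : chain m A'' B''),
    cmap Y Z -> cmap X Y -> cmap X Z :=
  match m with
  | 0%N => fun _ _ _ _ _ => tt
  | m'.+1 => fun X Y Z g f => (g.1 ∘ f.1, cmap_comp g.2 f.2)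
  end.

(* The component f_1, which is b when m = 0. *)
Definition cmap_first m A B A' B' : forall (X : chain m A B) (Y : chain m A' B'),
    cmap X Y -> hom B B' -> hom (target X) (target Y) :=
  match m with
  | 0%N => fun _ _ _ b => b
  | m'.+1 => fun X Y f _ => f.1
  end.

(* Homotopy (phi_1, ..., phi_{m+1}), phi_i : X_i -> Y_{i-1}, from (a', g, b') to
   (a, f, b): at each place, f_i - g_i = d^Y_{i-1} phi_i + phi_{i+1} d^X_i, with
   a term missing at either end.  In the recursion e stands for
   d^Y_{i-1} phi_i, which is 0 at the start. *)
Fixpoint homotopic_from m A B A' B' :
    forall (X : chain m A B) (Y : chain m A' B') (e : hom A A'),
    hom A A' -> cmap X Y -> hom B B' -> hom A A' -> cmap X Y -> hom B B' ->
    Prop :=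
  match m with
  | 0%N => fun X Y e a _ b a' _ b' =>
      exists phi : hom B A',
        a - a' = e + phi ∘ X /\ b - b' = Y ∘ phi
  | m'.+1 => fun X Y e a f b a' g b' =>
      exists phi : hom (obj X) A',
        a - a' = e + phi ∘ arr X /\
        homotopic_from (arr Y ∘ phi) f.1 f.2 b g.1 g.2 b'
  end.

Definition homotopic m A B A' B' (X : chain m A B) (Y : chain m A' B')
    (a : hom A A') (f : cmap X Y) (b : hom B B')
    (a' : hom A A') (g : cmap X Y) (b' : hom B B') : Prop :=
  homotopic_from 0 a f b a' g b'.

Definition homotopy_equivalent m A C (X Y : chain m A C) : Prop :=
  exists (f : cmap X Y) (g : cmap Y X),
    [/\ is_cmap (idm A) f (idm C),
        is_cmap (idm A) g (idm C),
        homotopic (idm A) (cmap_comp g f) (idm C) (idm A) (cmap_id X) (idm C)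
      & homotopic (idm A) (cmap_comp f g) (idm C) (idm A) (cmap_id Y) (idm C)].

Definition hclass m A C (X : chain m A C) : set (chain m A C) :=
  [set Y | is_complex Y /\ homotopy_equivalent X Y].

Fixpoint zero_chain m A B : chain m A B :=
  match m with
  | 0%N => 0
  | m'.+1 => Step zob 0 (zero_chain m' zob B)
  end.

Lemma is_cmap_id m A B (X : chain m A B) :
  is_cmap (idm A) (cmap_id X) (idm B).
Proof.
elim: m A X => [|m IH] A X /=; first by rewrite comp1m compm1.
by rewrite comp1m compm1; split.
Qed.

Lemma cmap_comp_id m A B (X : chain m A B) :
  cmap_comp (cmap_id X) (cmap_id X) = cmap_id X.
Proof. by elim: m A X => [|m IH] A X //=; rewrite comp1m IH. Qed.

Lemma homotopic_refl m A B A' B' (X : chain m A B) (Y : chain m A' B')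
  (a : hom A A') (f : cmap X Y) (b : hom B B') : homotopic a f b a f b.
Proof.
rewrite /homotopic; elim: m A A' X Y a f => [|m IH] A A' X Y a f /=.
  by exists 0; rewrite !subrr comp0m compm0 addr0.
by exists 0; rewrite subrr comp0m addr0 compm0; split=> //; exact: IH.
Qed.

Lemma hclass_refl m A C (X : chain m A C) : is_complex X -> hclass X X.
Proof.
move=> hX; split=> //; exists (cmap_id X), (cmap_id X).
by split; rewrite ?cmap_comp_id; [exact: is_cmap_id | exact: is_cmap_id
  | exact: homotopic_refl | exact: homotopic_refl].
Qed.

(* A =id= A -> 0 -> ... -> 0  and  0 -> ... -> 0 -> A =id= A; the case m = 0 is
   a dummy. *)
Definition id_left m A : chain m A zob :=
  match m with
  | 0%N => 0
  | m'.+1 => Step A (idm A) (zero_chain m' A zob)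
  end.

Definition id_right m A : chain m zob A :=
  match m with
  | 0%N => 0
  | m'.+1 => snoc (zero_chain m' zob A) (idm A)
  end.

(* For (f_0, f_1, ..., f_m, c) : X -> Y, the sequence
   X_1 + Y_0 -> X_2 + Y_1 -> ... -> X_{m+1} + Y_m -> E
   with blocks [-d^X_{i+1}, 0; f_{i+1}, d^Y_i], where the last arrow is
   [lst] applied to d^Y_m : Y_m -> Y_{m+1}. *)
Fixpoint cone_from m A B C D E : forall (X : chain m A C) (Y : chain m B D),
    cmap X Y -> (forall V, hom V D -> hom (C ⊕ V) E) ->
    chain m (target X ⊕ B) E :=
  match m with
  | 0%N => fun X Y _ lst => lst B Y
  | m'.+1 => fun X Y f lst =>
      Step (target (tail X) ⊕ obj Y)
           (blockm (- first_arr (tail X)) 0 f.1 (arr Y))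
           (cone_from f.2 lst)
  end.

(* Mapping cone of (id, f_1, ..., f_n, c) : X -> Y,
   X_1 -> X_2 + Y_1 -> ... -> X_{n+1} + Y_n -> Y_{n+1}. *)
Definition cone n A C D : forall (X : chain n A C) (Y : chain n A D),
    cmap X Y -> hom C D -> chain n (target X) D :=
  match n with
  | 0%N => fun _ _ _ c => c
  | n'.+1 => fun X Y f c =>
      Step (target (tail X) ⊕ obj Y)
           (colm (- first_arr (tail X)) f.1)
           (cone_from f.2 (fun V (d : hom V D) => rowm c d))
  end.

(* With u : X_i -> Y_i and d = d^Y_{i-1}, the sequence
   X_i + Y_{i-1} -> X_{i+1} + Y_i -> ... -> X_n + Y_{n-1} -> Y_n
   with blocks [d^X_i, 0; f_i, -d^Y_{i-1}] and last arrow [f_n, -d^Y_{n-1}]. *)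
Fixpoint cocone_from m A B C D V : forall (X : chain m A C) (Y : chain m B D),
    cmap X Y -> hom A B -> hom V B -> chain m (A ⊕ V) (source Y) :=
  match m with
  | 0%N => fun X Y _ u d => rowm u (- d)
  | m'.+1 => fun X Y f u d =>
      Step (obj X ⊕ B) (blockm (arr X) 0 u (- d))
           (cocone_from f.2 f.1 (arr Y))
  end.

(* Mapping cocone of (a, f_1, ..., f_n, id) : X -> Y,
   X_0 -> X_1 + Y_0 -> ... -> X_n + Y_{n-1} -> Y_n: the mapping cone formed in
   the opposite category, so that the signs are carried by d^Y. *)
Definition cocone n A B C : forall (X : chain n A C) (Y : chain n B C),
    hom A B -> cmap X Y -> chain n A (source Y) :=
  match n with
  | 0%N => fun _ _ a _ => a
  | n'.+1 => fun X Y a f =>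
      Step (obj X ⊕ B) (colm (arr X) a) (cocone_from f.2 f.1 (arr Y))
  end.

Fixpoint chain_sum m A B A' B' :
    chain m A B -> chain m A' B' -> chain m (A ⊕ A') (B ⊕ B') :=
  match m with
  | 0%N => fun X Y => blockm X 0 0 Y
  | m'.+1 => fun X Y =>
      Step (obj X ⊕ obj Y) (blockm (arr X) 0 0 (arr Y))
           (chain_sum (tail X) (tail Y))
  end.

End Chains.

Arguments id_left {_} _ _.
Arguments id_right {_} _ _.

Fixpoint map_chain (T T' : additiveCat) (F : functorData T T') m (A B : T) :
    chain m A B -> chain m (F A) (F B) :=
  match m with
  | 0%N => fun X => fmap F X
  | m'.+1 => fun X => Step (F (obj X)) (fmap F (arr X)) (map_chain F (tail X))
  end.

Record extBifunctor (T : additiveCat) := ExtBifunctor {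
  ext :> T -> T -> zmodType;
  push : forall C A A' : T, hom A A' -> {additive ext C A -> ext C A'};
  pull : forall C C' A : T, hom C' C -> {additive ext C A -> ext C' A};
  push_id : forall (C A : T) (d : ext C A), push C (idm A) d = d;
  pull_id : forall (C A : T) (d : ext C A), pull A (idm C) d = d;
  push_comp : forall (C A A' A'' : T) (b : hom A' A'') (a : hom A A')
    (d : ext C A), push C (b ∘ a) d = push C b (push C a d);
  pull_comp : forall (C C' C'' A : T) (c : hom C' C) (b : hom C'' C')
    (d : ext C A), pull A (c ∘ b) d = pull A b (pull A c d);
  push_pull : forall (C C' A A' : T) (a : hom A A') (c : hom C' C)
    (d : ext C A), push C' a (pull A c d) = pull A' c (push C a d);
  pushD : forall (C A A' : T) (a a' : hom A A') (d : ext C A),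
    push C (a + a') d = push C a d + push C a' d;
  pullD : forall (C C' A : T) (c c' : hom C' C) (d : ext C A),
    pull A (c + c') d = pull A c d + pull A c' d
}.

Arguments push {_ _ _ _ _} _.
Arguments pull {_ _ _ _ _} _.

Definition exact_at (U V W : zmodType) (f : U -> V) (g : V -> W) : Prop :=
  forall v, g v = 0 <-> exists u, f u = v.

Section Exangulated.
Variables (T : additiveCat) (E : extBifunctor T) (n : nat).
Implicit Types A B C D W : T.

(* Exactness of T(W, X_0) -> ... -> T(W, X_{m+1}) at X_1, ..., X_m. *)
Fixpoint cov_exact W m A C : chain m A C -> Prop :=
  match m with
  | 0%N => fun _ => True
  | m'.+1 => fun X =>
      exact_at (fun f : hom W A => arr X ∘ f)
               (fun f : hom W (obj X) => first_arr (tail X) ∘ f) /\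
      cov_exact W (tail X)
  end.

(* Exactness of T(X_{m+1}, W) -> ... -> T(X_0, W) at X_m, ..., X_1. *)
Fixpoint contra_exact W m A C : chain m A C -> Prop :=
  match m with
  | 0%N => fun _ => True
  | m'.+1 => fun X =>
      exact_at (fun g : hom (target (tail X)) W => g ∘ first_arr (tail X))
               (fun g : hom (obj X) W => g ∘ arr X) /\
      contra_exact W (tail X)
  end.

Record is_exangle A C (X : chain n A C) (d : E C A) : Prop := IsExangle {
  exangle_complex : is_complex X;
  exangle_push : push (first_arr X) d = 0;
  exangle_pull : pull (last_arr X) d = 0;
  exangle_cov : forall W,
    cov_exact W X /\
    exact_at (fun f : hom W (source X) => last_arr X ∘ f)
             (fun f : hom W C => pull f d);
  exangle_contra : forall W,
    contra_exact W X /\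
    exact_at (fun g : hom (target X) W => g ∘ first_arr X)
             (fun g : hom A W => push g d)
}.

(* s d is the homotopy class assigned to d, as a set of complexes, so that
   "s d X" says that <X, d> is distinguished. *)
Definition assignment : Type := forall C A : T, E C A -> set (chain n A C).

Variable s : assignment.

Record is_exact_realization : Prop := IsExactRealization {
  real_class : forall C A (d : E C A),
    exists2 X : chain n A C, is_complex X & s d = hclass X;
  real_R0 : forall A B C D (d : E C A) (r : E D B)
      (X : chain n A C) (Y : chain n B D) (a : hom A B) (c : hom C D),
    s d X -> s r Y -> push a d = pull c r ->
    exists f : cmap X Y, is_cmap a f c;
  real_R1 : forall A C (d : E C A) (X : chain n A C), s d X -> is_exangle X d;
  real_R2l : forall A, s (0 : E zob A) = hclass (id_left n A);
  real_R2r : forall A, s (0 : E A zob) = hclass (id_right n A)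
}.

Definition is_inflation A B (f : hom A B) : Prop :=
  exists (C : T) (d : E C A) (X : chain n A C), s d X /\ is_first X f.

Definition is_deflation B C (g : hom B C) : Prop :=
  exists (A : T) (d : E C A) (X : chain n A C), s d X /\ is_last X g.

Record is_exangulated : Prop := IsExangulated {
  exang_real : is_exact_realization;
  exang_EA1i : forall A B C (g : hom B C) (f : hom A B),
    is_inflation f -> is_inflation g -> is_inflation (g ∘ f);
  exang_EA1d : forall A B C (g : hom B C) (f : hom A B),
    is_deflation f -> is_deflation g -> is_deflation (g ∘ f);
  exang_EA2 : forall A C D (r : E D A) (c : hom C D)
      (X : chain n A C) (Y : chain n A D),
    s (pull c r) X -> s r Y ->
    exists f : cmap X Y,
      is_cmap (idm A) f c /\ s (push (first_arr X) r) (cone f c);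
  exang_EA2op : forall A B C (d : E C A) (a : hom A B)
      (X : chain n A C) (Y : chain n B C),
    s d X -> s (push a d) Y ->
    exists f : cmap X Y,
      is_cmap a f (idm C) /\ s (pull (last_arr Y) d) (cocone a f)
}.

Definition is_projective P : Prop :=
  forall A C (d : E C A) (X : chain n A C), s d X ->
  forall g : hom P C, exists h : hom P (source X), g = last_arr X ∘ h.

Definition is_injective I : Prop :=
  forall A C (d : E C A) (X : chain n A C), s d X ->
  forall g : hom A I, exists h : hom (target X) I, g = h ∘ first_arr X.

Record is_frobenius : Prop := IsFrobenius {
  frob_proj : forall C, exists (B : T) (d : E C B) (X : chain n B C),
    s d X /\ all_mid is_projective X;
  frob_inj : forall A, exists (D : T) (d : E D A) (X : chain n A D),
    s d X /\ all_mid is_injective X;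
  frob_eq : forall P, is_projective P <-> is_injective P
}.

Definition is_left_approx (P : T -> Prop) A I (i : hom A I) : Prop :=
  P I /\ forall J (f : hom A J), P J -> exists g : hom I J, f = g ∘ i.

Definition is_right_approx (P : T -> Prop) C I (i : hom I C) : Prop :=
  P I /\ forall J (f : hom J C), P J -> exists g : hom J I, f = i ∘ g.

Record Iexangle (X : T) := IExangle {
  Iex_S : T;
  Iex_ext : E Iex_S X;
  Iex_seq : chain n X Iex_S;
  Iex_dist : s Iex_ext Iex_seq;
  Iex_inj : all_mid is_injective Iex_seq;
  Iex_left : is_left_approx is_injective (first_arr Iex_seq);
  Iex_right : is_right_approx is_injective (last_arr Iex_seq)
}.

End Exangulated.

Record addClass (T : additiveCat) := AddClass {
  in_class :> T -> Prop;
  class_zob : in_class zob;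
  class_bip : forall A B, in_class A -> in_class B -> in_class (A ⊕ B)
}.

Section Quotient.
Variables (T : additiveCat) (J : addClass T).
Implicit Types A B C D : T.

Definition factors A B : {pred hom A B} := fun f =>
  `[< exists (I : T) (v : hom I B) (u : hom A I), J I /\ f = v ∘ u >].

Lemma factors_zmod_closed A B : zmod_closed (@factors A B).
Proof.
split=> [|f g /asboolP[I [v [u [JI ->]]]] /asboolP[I' [v' [u' [JI' ->]]]]].
  by apply/asboolP; exists zob, 0, 0; split; [exact: class_zob|rewrite comp0m].
apply/asboolP; exists (I ⊕ I'), (rowm v v'), (colm u (- u')).
split; first exact: class_bip.
rewrite /rowm /colm compDl !compDr -!compA !(compA pr1) !(compA pr2).
rewrite pr1_in1 pr2_in2 pr1_in2 pr2_in1 !comp1m !comp0m !compm0.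
by rewrite addr0 add0r compNr.
Qed.

HB.instance Definition _ A B :=
  GRing.isZmodClosed.Build (hom A B) (@factors A B) (factors_zmod_closed A B).

Definition qhom A B : zmodType := {ideal_quot (@factors A B)}.

Definition qpi A B (f : hom A B) : qhom A B := \pi_(qhom A B) f.

Definition qcomp A B C (g : qhom B C) (f : qhom A B) : qhom A C :=
  qpi (repr g ∘ repr f).

Lemma qpiP A B (f g : hom A B) : qpi f = qpi g <-> f - g \in @factors A B.
Proof.
rewrite (Quotient.idealrBE (@factors A B) f g).
by split=> [/eqP|/eqP].
Qed.

Lemma qpiD A B (f g : hom A B) : qpi (f + g) = qpi f + qpi g.
Proof. by rewrite /qpi raddfD. Qed.

Lemma qpi_repr A B (f : qhom A B) : qpi (repr f) = f.
Proof. exact: reprK. Qed.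

Lemma qpi_comp A B C (g : hom B C) (f : hom A B) :
  qpi (g ∘ f) = qcomp (qpi g) (qpi f).
Proof.
have /qpiP/asboolP[I [v [u [JI e]]]] := qpi_repr (qpi f).
have /qpiP/asboolP[I' [v' [u' [JI' e']]]] := qpi_repr (qpi g).
apply/qpiP; rewrite -opprB rpredN.
have -> : repr (qpi g) ∘ repr (qpi f) - g ∘ f =
  repr (qpi g) ∘ (repr (qpi f) - f) + (repr (qpi g) - g) ∘ f.
  by rewrite compBr compBl addrA subrK.
apply: rpredD; apply/asboolP.
  by exists I, (repr (qpi g) ∘ v), u; rewrite e compA.
by exists I', v', (u' ∘ f); rewrite e' compA.
Qed.

Lemma qcomp1m A B (f : qhom A B) : qcomp (qpi (idm B)) f = f.
Proof. by rewrite -{1}(qpi_repr f) -qpi_comp comp1m qpi_repr. Qed.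

Lemma qcompm1 A B (f : qhom A B) : qcomp f (qpi (idm A)) = f.
Proof. by rewrite -{1}(qpi_repr f) -qpi_comp compm1 qpi_repr. Qed.

Lemma qcompA A B C D (h : qhom C D) (g : qhom B C) (f : qhom A B) :
  qcomp h (qcomp g f) = qcomp (qcomp h g) f.
Proof.
rewrite -(qpi_repr f) -(qpi_repr g) -(qpi_repr h).
by rewrite -!qpi_comp compA.
Qed.

Lemma qcompDl A B C (g g' : qhom B C) (f : qhom A B) :
  qcomp (g + g') f = qcomp g f + qcomp g' f.
Proof.
rewrite -(qpi_repr f) -(qpi_repr g) -(qpi_repr g').
by rewrite -qpiD -!qpi_comp compDl qpiD.
Qed.

Lemma qcompDr A B C (g : qhom B C) (f f' : qhom A B) :
  qcomp g (f + f') = qcomp g f + qcomp g f'.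
Proof.
rewrite -(qpi_repr f) -(qpi_repr g) -(qpi_repr f').
by rewrite -qpiD -!qpi_comp compDr qpiD.
Qed.

Lemma qpi0 A B : qpi (0 : hom A B) = 0.
Proof. by rewrite /qpi raddf0. Qed.

Lemma q_to_zob A (f : qhom A zob) : f = 0.
Proof. by rewrite -(qpi_repr f) (to_zob (repr f)) qpi0. Qed.

Lemma q_from_zob A (f : qhom zob A) : f = 0.
Proof. by rewrite -(qpi_repr f) (from_zob (repr f)) qpi0. Qed.

Lemma q_pr1_in1 A B : qcomp (qpi (@pr1 T A B)) (qpi in1) = qpi (idm A).
Proof. by rewrite -qpi_comp pr1_in1. Qed.

Lemma q_pr2_in2 A B : qcomp (qpi (@pr2 T A B)) (qpi in2) = qpi (idm B).
Proof. by rewrite -qpi_comp pr2_in2. Qed.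

Lemma q_pr1_in2 A B : qcomp (qpi (@pr1 T A B)) (qpi in2) = 0.
Proof. by rewrite -qpi_comp pr1_in2 qpi0. Qed.

Lemma q_pr2_in1 A B : qcomp (qpi (@pr2 T A B)) (qpi in1) = 0.
Proof. by rewrite -qpi_comp pr2_in1 qpi0. Qed.

Lemma q_bipE A B :
  qcomp (qpi (@in1 T A B)) (qpi pr1) + qcomp (qpi in2) (qpi pr2) =
  qpi (idm (A ⊕ B)).
Proof. by rewrite -!qpi_comp -qpiD bipE. Qed.

Definition quotCat : additiveCat :=
  @AdditiveCat T qhom (fun A => qpi (idm A)) qcomp qcomp1m qcompm1 qcompA
    qcompDl qcompDr zob q_to_zob q_from_zob (@bip T)
    (fun A B => qpi in1) (fun A B => qpi in2)
    (fun A B => qpi pr1) (fun A B => qpi pr2)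
    q_pr1_in1 q_pr2_in2 q_pr1_in2 q_pr2_in1 q_bipE.

Definition quotFunctor : functorData T quotCat :=
  @FunctorData T quotCat (fun A => A) qpi.

End Quotient.

Section Angulated.
Variables (n : nat) (T : additiveCat) (S : functorData T T).

Record Sseq := SSeq {
  sfst : T;
  slst : T;
  schain : chain n sfst slst;
  smap : hom slst (S sfst)
}.

Definition is_smor (X Y : Sseq) (a : hom (sfst X) (sfst Y))
    (f : cmap (schain X) (schain Y)) (c : hom (slst X) (slst Y)) : Prop :=
  is_cmap a f c /\ smap Y ∘ c = fmap S a ∘ smap X.

Definition sseq_iso (X Y : Sseq) : Prop :=
  exists (a : hom (sfst X) (sfst Y)) (f : cmap (schain X) (schain Y))
         (c : hom (slst X) (slst Y))
         (a' : hom (sfst Y) (sfst X)) (f' : cmap (schain Y) (schain X))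
         (c' : hom (slst Y) (slst X)),
    [/\ is_smor a f c, is_smor a' f' c',
        [/\ a' ∘ a = idm _, cmap_comp f' f = cmap_id _ & c' ∘ c = idm _]
      & [/\ a ∘ a' = idm _, cmap_comp f f' = cmap_id _ & c ∘ c' = idm _]].

(* The last arrow lands in S (X_0 + Y_0), identified with S X_0 + S Y_0 along
   [S in1, S in2]; likewise in [sseq_cone]. *)
Definition sseq_sum (X Y : Sseq) : Sseq :=
  SSeq (chain_sum (schain X) (schain Y))
       (rowm (fmap S in1 ∘ smap X) (fmap S in2 ∘ smap Y)).

Definition sseq_id (A : T) : Sseq := SSeq (id_left n A) 0.

(* X_1 -> ... -> X_{n+1} -> S X_0 -> S X_1 with last arrow (-1)^n S alpha_0 *)
Definition rotate_chain (m : nat) (A C D : T) :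
    forall X : chain m A C, hom C D -> chain m (target X) D :=
  match m with
  | 0%N => fun _ h => h
  | m'.+1 => fun X h => snoc (tail X) h
  end.

Definition rotate (X : Sseq) : Sseq :=
  SSeq (rotate_chain (schain X) (smap X))
       (fmap S (first_arr (schain X)) *~ (-1) ^+ n).

(* X_1 + Y_0 -> ... -> X_{n+1} + Y_n -> S X_0 + Y_{n+1} -> S X_1 + S Y_0 *)
Definition sseq_cone (X Y : Sseq) (a : hom (sfst X) (sfst Y))
    (f : cmap (schain X) (schain Y)) (c : hom (slst X) (slst Y)) : Sseq :=
  SSeq (cone_from f (fun V (d : hom V (slst Y)) => blockm (- smap X) 0 c d))
       (rowm (fmap S in1 ∘ (- fmap S (first_arr (schain X))) + fmap S in2 ∘ fmap S a)
             (fmap S in2 ∘ smap Y)).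

Record is_angulated (angle : set Sseq) : Prop := IsAngulated {
  ang_shift : is_autoequivalence S;
  ang_F1_iso : forall X Y, sseq_iso X Y -> angle X -> angle Y;
  ang_F1_sum : forall X Y, angle X -> angle Y -> angle (sseq_sum X Y);
  ang_F1_summand : forall X Y, angle (sseq_sum X Y) -> angle X /\ angle Y;
  ang_F1_id : forall A, angle (sseq_id A);
  ang_F1_ex : forall (A B : T) (f : hom A B),
    exists (C : T) (X : chain n A C) (h : hom C (S A)),
      angle (SSeq X h) /\ is_first X f;
  ang_F2 : forall X, angle X <-> angle (rotate X);
  ang_F3 : forall X Y (a : hom (sfst X) (sfst Y))
      (b : hom (target (schain X)) (target (schain Y))),
    angle X -> angle Y -> b ∘ first_arr (schain X) = first_arr (schain Y) ∘ a ->
    exists (f : cmap (schain X) (schain Y)) (c : hom (slst X) (slst Y)),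
      is_smor a f c /\ cmap_first f c = b;
  ang_F4 : forall X Y (a : hom (sfst X) (sfst Y))
      (b : hom (target (schain X)) (target (schain Y))),
    angle X -> angle Y -> b ∘ first_arr (schain X) = first_arr (schain Y) ∘ a ->
    exists (f : cmap (schain X) (schain Y)) (c : hom (slst X) (slst Y)),
      [/\ is_smor a f c, cmap_first f c = b & angle (sseq_cone a f c)]
}.

End Angulated.

Arguments is_angulated n T S angle : clear implicits.

Section Stable.
Variables (T : additiveCat) (E : extBifunctor T) (n : nat) (s : assignment E n).

Lemma injective_zob : is_injective s zob.
Proof.
by move=> A C d X _ g; exists 0; rewrite (to_zob g) comp0m.
Qed.

Lemma injective_bip (I I' : T) :
  is_injective s I -> is_injective s I' -> is_injective s (I ⊕ I').
Proof.
move=> hI hI' A C d X sX g.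
have [h e] := hI A C d X sX (pr1 ∘ g).
have [h' e'] := hI' A C d X sX (pr2 ∘ g).
exists (colm h h').
by rewrite /colm compDl -!compA -e -e' !compA -compDl bipE comp1m.
Qed.

Definition injectives : addClass T :=
  @AddClass T (is_injective s) injective_zob injective_bip.

Definition stableCat : additiveCat := quotCat injectives.

Definition stabilize : functorData T stableCat := quotFunctor injectives.

(* The action of stable morphisms on extensions: the induced bifunctor on the
   stable category has the values of E.  It does not depend on the
   representative when injectives are projective, see [stable_pull_pi]. *)
Definition stable_pull (C C' A : T) (c : @hom stableCat C' C) (d : E C A) :
  E C' A := pull (repr c) d.

Lemma stable_pull_pi (C C' A : T) (c : hom C' C) (d : E C A) :
  is_exact_realization s -> is_frobenius s ->
  stable_pull (fmap stabilize c) d = pull c d.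
Proof.
move=> hs hF; rewrite /stable_pull.
have /qpiP/asboolP[I [v [u [JI e]]]] := qpi_repr (fmap stabilize c).
rewrite -[repr _](subrK c) pullD e pull_comp.
suff -> : pull v d = 0 by rewrite raddf0 add0r.
have [X hX sX] := real_class hs (pull v d).
have sXX : s (pull v d) X by rewrite sX; exact: hclass_refl.
have [h hh] := (frob_eq hF I).2 JI _ _ _ _ sXX (idm I).
by rewrite -[LHS]pull_id hh pull_comp (exangle_pull (real_R1 hs sXX)) raddf0.
Qed.

Definition stable_class (C A : T) (d : E C A) :
    set (@chain stableCat n A C) :=
  [set Z | exists2 X : chain n A C, s d X & hclass (map_chain stabilize X) Z].

Variable e : forall X : T, Iexangle s X.

(* For phi the class of f, S phi is the class of any g : S X -> S Y with
   f_* delta^X = g^* delta^Y; [xget] returns the morphism thus characterized. *)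
Definition S_map (X Y : T) (phi : @hom stableCat X Y) :
    @hom stableCat (Iex_S (e X)) (Iex_S (e Y)) :=
  xget 0 [set psi | exists (f : hom X Y) (g : hom (Iex_S (e X)) (Iex_S (e Y))),
    [/\ phi = fmap stabilize f, psi = fmap stabilize g
      & push f (Iex_ext (e X)) = pull g (Iex_ext (e Y))]].

Definition S_functor : functorData stableCat stableCat :=
  @FunctorData stableCat stableCat (fun X => Iex_S (e X)) S_map.

Definition S_sequences : set (Sseq n S_functor) :=
  [set X : Sseq n S_functor |
    stable_class (stable_pull (smap X) (Iex_ext (e (sfst X)))) (schain X)].

End Stable.

Arguments S_sequences {T E n s} e _.

(* Main.v *)
From mathcomp Require Import all_boot ssralg ssrint boolp classical_sets.
Require Import Defs.

(* In the stable category E(C, A) becomes Hom(C, S A) through h |-> h^* delta^A,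
   so that (n+2)-angles can be handled as complexes realizing an extension.  A
   complex Z realizes delta as soon as it is exact for the covariant Hom functors
   and admits one chain map, with identity ends, to or from a realization of
   delta: a map in the other direction is then built from the right end, and two
   complexes related by maps in both directions are homotopy equivalent.  With
   this criterion every axiom reduces to writing down a chain map.  (EA2) for
   delta^A, whose middle terms are stably zero, gives the rotation, and
   (EA2^op) its converse.  For the mapping cone of a morphism X -> Y with left
   components (a, b), replace X by X + (Y_0 = Y_0), twisted by a, and Y by
   Y + (X_0 -> 0 -> S X_0): the new morphism has an identity on the left, its
   cone is the wanted one, and (EA2) applies to it after a homotopy that
   prescribes the component b. *)

Set Implicit Arguments.
Unset Strict Implicit.
Unset Printing Implicit Defensive.

Import GRing.Theory.
Local Open Scope ring_scope.

(** * Chain maps and homotopies *)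

(** The obstacle is that a stable class contains every complex that is homotopy equivalent, in the
    stable category, to the image of a distinguished n-exangle, and neither such a complex nor its
    chain maps need lift to the exangulated category. The argument therefore retains only properties
    shared by all representatives, [is_cov_realization], and properties of the functor S,
    [is_shift]; the angulation is derived from these two records, which are verified for the stable
    category at the end. Covariant exactness lets maps be built from the right, but leaves their
    left end undetermined: after a homotopy the error is still an arbitrary morphism killed by the
    first arrow. The Hom sequences contain nothing to the left of X_0. What replaces the missing
    term is exactness of Hom(W, C) -> E(W, A) -> E(W, X_1), a consequence of (EA2), taken at W = S
    V, where E(S V, A) is Hom(V, A). The Frobenius condition enters through the vanishing of E on
    injectives in both variables. *)

Section Matrices.
Variable T : additiveCat.
Implicit Types A B C D : T.

Lemma compMzl A B C (g : hom B C) (f : hom A B) (z : int) :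
  (g *~ z) ∘ f = (g ∘ f) *~ z.
Proof.
have hn n : (g *+ n) ∘ f = (g ∘ f) *+ n.
  by elim: n => [|n IH]; rewrite ?mulr0n ?comp0m // !mulrS compDl IH.
by case: z => n; rewrite ?NegzE ?mulrNz -!pmulrn ?compNl hn.
Qed.

Lemma compMzr A B C (g : hom B C) (f : hom A B) (z : int) :
  g ∘ (f *~ z) = (g ∘ f) *~ z.
Proof.
have hn n : g ∘ (f *+ n) = (g ∘ f) *+ n.
  by elim: n => [|n IH]; rewrite ?mulr0n ?compm0 // !mulrS compDr IH.
by case: z => n; rewrite ?NegzE ?mulrNz -!pmulrn ?compNr hn.
Qed.

Lemma pr1_colm A C D (f : hom A C) (g : hom A D) : pr1 ∘ colm f g = f.
Proof.
by rewrite /colm compDr !compA pr1_in1 pr1_in2 comp1m comp0m addr0.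
Qed.

Lemma pr2_colm A C D (f : hom A C) (g : hom A D) : pr2 ∘ colm f g = g.
Proof.
by rewrite /colm compDr !compA pr2_in1 pr2_in2 comp1m comp0m add0r.
Qed.

Lemma rowm_in1 A B C (f : hom A C) (g : hom B C) : rowm f g ∘ in1 = f.
Proof.
by rewrite /rowm compDl -!compA pr1_in1 pr2_in1 compm1 compm0 addr0.
Qed.

Lemma rowm_in2 A B C (f : hom A C) (g : hom B C) : rowm f g ∘ in2 = g.
Proof.
by rewrite /rowm compDl -!compA pr1_in2 pr2_in2 compm1 compm0 add0r.
Qed.

Lemma colm_ext A C D (f g : hom A (C ⊕ D)) :
  pr1 ∘ f = pr1 ∘ g -> pr2 ∘ f = pr2 ∘ g -> f = g.
Proof.
by move=> e1 e2; rewrite -[f]comp1m -[g]comp1m -bipE !compDl -!compA e1 e2.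
Qed.

Lemma rowm_ext A B C (f g : hom (A ⊕ B) C) :
  f ∘ in1 = g ∘ in1 -> f ∘ in2 = g ∘ in2 -> f = g.
Proof.
by move=> e1 e2; rewrite -[f]compm1 -[g]compm1 -bipE !compDr !compA e1 e2.
Qed.

Lemma colm_comp A B C D (f : hom B C) (g : hom B D) (h : hom A B) :
  colm f g ∘ h = colm (f ∘ h) (g ∘ h).
Proof. by rewrite /colm compDl !compA. Qed.

Lemma comp_rowm A B C D (f : hom A C) (g : hom B C) (h : hom C D) :
  h ∘ rowm f g = rowm (h ∘ f) (h ∘ g).
Proof. by rewrite /rowm compDr !compA. Qed.

Lemma rowm_colm A B C D (f : hom B D) (g : hom C D) (u : hom A B)
  (v : hom A C) : rowm f g ∘ colm u v = f ∘ u + g ∘ v.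
Proof. by rewrite /rowm compDl -!compA pr1_colm pr2_colm. Qed.

Lemma blockm_colm A B C D F (a : hom A C) (b : hom B C) (c : hom A D)
    (d : hom B D) (u : hom F A) (v : hom F B) :
  blockm a b c d ∘ colm u v = colm (a ∘ u + b ∘ v) (c ∘ u + d ∘ v).
Proof. by rewrite /blockm colm_comp !rowm_colm. Qed.

Lemma pr1_blockm A B C D (a : hom A C) (b : hom B C) (c : hom A D)
  (d : hom B D) : pr1 ∘ blockm a b c d = rowm a b.
Proof. exact: pr1_colm. Qed.

Lemma pr2_blockm A B C D (a : hom A C) (b : hom B C) (c : hom A D)
  (d : hom B D) : pr2 ∘ blockm a b c d = rowm c d.
Proof. exact: pr2_colm. Qed.

Lemma blockm_in1 A B C D (a : hom A C) (b : hom B C) (c : hom A D)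
  (d : hom B D) : blockm a b c d ∘ in1 = colm a c.
Proof. by rewrite /blockm colm_comp !rowm_in1. Qed.

Lemma blockm_in2 A B C D (a : hom A C) (b : hom B C) (c : hom A D)
  (d : hom B D) : blockm a b c d ∘ in2 = colm b d.
Proof. by rewrite /blockm colm_comp !rowm_in2. Qed.

Lemma blockm_blockm A B C D F G (a : hom A C) (b : hom B C) (c : hom A D)
    (d : hom B D) (a' : hom F A) (b' : hom G A) (c' : hom F B) (d' : hom G B) :
  blockm a b c d ∘ blockm a' b' c' d' =
  blockm (a ∘ a' + b ∘ c') (a ∘ b' + b ∘ d')
         (c ∘ a' + d ∘ c') (c ∘ b' + d ∘ d').
Proof.
by apply: rowm_ext; rewrite -compA ?blockm_in1 ?blockm_in2 blockm_colm.
Qed.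

Lemma rowm_blockm A B C D F (x : hom C F) (y : hom D F) (a : hom A C)
    (b : hom B C) (c : hom A D) (d : hom B D) :
  rowm x y ∘ blockm a b c d = rowm (x ∘ a + y ∘ c) (x ∘ b + y ∘ d).
Proof.
by apply: rowm_ext; rewrite -compA ?blockm_in1 ?blockm_in2 rowm_colm
  ?rowm_in1 ?rowm_in2.
Qed.

Lemma colm_eta A C D (f : hom A (C ⊕ D)) : f = colm (pr1 ∘ f) (pr2 ∘ f).
Proof. by apply: colm_ext; rewrite ?pr1_colm ?pr2_colm. Qed.

End Matrices.

Section ChainMaps.
Variable T : additiveCat.
Implicit Types A B C D : T.

Lemma cmap_firstP m A B A' B' (X : chain m A B) (Y : chain m A' B')
    (a : hom A A') (f : cmap X Y) (b : hom B B') :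
  is_cmap a f b -> cmap_first f b ∘ first_arr X = first_arr Y ∘ a.
Proof. by case: m X Y f => [|m] X Y f //= []. Qed.

Lemma is_cmap_last m A B A' B' (X : chain m A B) (Y : chain m A' B')
    (a : hom A A') (f : cmap X Y) (b : hom B B') :
  is_cmap a f b ->
  exists y : hom (source X) (source Y), last_arr Y ∘ y = b ∘ last_arr X.
Proof.
elim: m A A' X Y a f => [|m IH] A A' X Y a f /=; first by exists a.
by case=> _; exact: IH.
Qed.

(** The left end enters the chain-map equations only through its composite with the first arrow of
    [Y]. This freedom is what allows wrong left ends to be corrected. *)
Lemma is_cmap_start m A B A' B' (X : chain m A B) (Y : chain m A' B')
    (a a' : hom A A') (f : cmap X Y) (b : hom B B') :
  first_arr Y ∘ a' = first_arr Y ∘ a -> is_cmap a f b -> is_cmap a' f b.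
Proof. by case: m X Y f => [|m] X Y f /= ->. Qed.

Lemma is_cmap_comp m A B A' B' A'' B'' (X : chain m A B) (Y : chain m A' B')
    (Z : chain m A'' B'') (a : hom A A') (f : cmap X Y) (b : hom B B')
    (a' : hom A' A'') (g : cmap Y Z) (b' : hom B' B'') :
  is_cmap a f b -> is_cmap a' g b' ->
  is_cmap (a' ∘ a) (cmap_comp g f) (b' ∘ b).
Proof.
elim: m A A' A'' X Y Z a f a' g => [|m IH] A A' A'' X Y Z a f a' g /=.
  by move=> e e'; rewrite -compA e !compA e'.
move=> [e h] [e' h']; split; first by rewrite -compA e !compA e'.
exact: IH.
Qed.

Lemma is_cmap_scale m A B A' B' (X : chain m A B) (Y : chain m A' B')
    (a : hom A A') (f : cmap X Y) (b : hom B B') (z : int) :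
  is_cmap a f b -> exists f' : cmap X Y, is_cmap (a *~ z) f' (b *~ z).
Proof.
elim: m A A' X Y a f => [|m IH] A A' X Y a f /=.
  by exists tt; rewrite compMzl compMzr H.
case=> e /IH[f' h]; exists (f.1 *~ z, f'); split=> //=.
by rewrite compMzl compMzr e.
Qed.

(** Exactness of [Y] lets the components be chosen one after the other from the right. At the left
    end no condition is left to impose, so [a] is whatever comes out. *)
Lemma cmap_lift_right m A B C D (X : chain m A C) (Y : chain m B D)
    (c : hom C D) :
  is_complex X -> (forall W, cov_exact W Y) ->
  (exists y : hom (source X) (source Y), last_arr Y ∘ y = c ∘ last_arr X) ->
  exists (a : hom A B) (f : cmap X Y), is_cmap a f c.
Proof.
elim: m A B X Y => [|m IH] A B X Y /=; first by move=> _ _ [y e]; exists y, tt.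
case=> e cX hY /(IH _ _ _ _ cX (fun W => (hY W).2))[a [f h]].
have [|u eu] := (((hY A).1 (a ∘ arr X)).1).
  by rewrite compA -(cmap_firstP h) -compA e compm0.
by exists u, (a, f).
Qed.

(** A homotopy is built from the right, where the two maps agree. It stops one step short: exactness
    says nothing about the kernel of the first arrow of [Y], so [a - a'] is controlled only up to
    that kernel. *)
Lemma homotopy_right m A B C D (X : chain m A C) (Y : chain m B D)
    (a a' : hom A B) (f f' : cmap X Y) (c : hom C D) :
  is_complex X -> (forall W, cov_exact W Y) ->
  is_cmap a f c -> is_cmap a' f' c ->
  exists psi : hom (target X) B,
    first_arr Y ∘ (a - a' - psi ∘ first_arr X) = 0.
Proof.
elim: m A B X Y a a' f f' => [|m IH] A B X Y a a' f f' /=.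
  by move=> _ _ e e'; exists 0; rewrite comp0m subr0 compBr -e -e' subrr.
move=> [e cX] hY [h1 h] [h1' h'].
have [psi2 e2] := IH _ _ _ _ _ _ _ _ cX (fun W => (hY W).2) h h'.
have [psi e1] := ((hY _).1 _).1 e2.
exists psi; rewrite !compBr -h1 -h1' compA e1 !compBl -compA e compm0 subr0.
exact: subrr.
Qed.

(** Subtracts the null-homotopic map with single component [psi], which touches only places 0 and 1;
    [cmap_shift_right] does the same at the other end. *)
Lemma cmap_shift_left m A B C D (X : chain m.+1 A C) (Y : chain m.+1 B D)
    (a : hom A B) (f : cmap X Y) (c : hom C D) (psi : hom (obj X) B) :
  is_complex Y -> is_cmap a f c ->
  exists f' : cmap X Y, is_cmap (a - psi ∘ arr X) f' c.
Proof.
move=> [e _] [h1 h2]; exists (f.1 - arr Y ∘ psi, f.2); split=> /=.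
  by rewrite compBl compBr h1 compA.
by apply: is_cmap_start h2; rewrite compBr compA e comp0m subr0.
Qed.

Lemma cmap_shift_right m A B C D (X : chain m.+1 A C) (Y : chain m.+1 B D)
    (a : hom A B) (f : cmap X Y) (c : hom C D) (psi : hom C (source Y)) :
  is_complex X -> is_cmap a f c ->
  exists f' : cmap X Y, is_cmap a f' (c - last_arr Y ∘ psi).
Proof.
elim: m A B X Y a f psi => [|m IH] A B X Y a f psi.
  move=> /= [e _] [h1 h2]; exists (f.1 - psi ∘ tail X, tt); split=> /=.
    by rewrite compBl -compA e compm0 subr0.
  by rewrite compBl compBr h2 -!compA.
case=> e cX [h1 h2]; have [f' h'] := IH _ _ _ _ _ _ psi cX h2.
by exists (f.1, f').
Qed.

(* The inverse 2 g - g f g of f up to (1 - g f)^2, by Newton's iteration. *)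
Fixpoint cmap_newton m A B A' B' : forall (X : chain m A B) (Y : chain m A' B'),
    cmap X Y -> cmap Y X -> cmap Y X :=
  match m with
  | 0%N => fun _ _ _ _ => tt
  | m'.+1 => fun X Y f g =>
      (g.1 + g.1 - g.1 ∘ (f.1 ∘ g.1), cmap_newton f.2 g.2)
  end.

Fixpoint cmap_quad m A B : forall X : chain m A B, cmap X X -> cmap X X :=
  match m with
  | 0%N => fun _ _ => tt
  | m'.+1 => fun X f => (f.1 + f.1 - f.1 ∘ f.1, cmap_quad f.2)
  end.

Lemma cmap_newton_comp m A B A' B' (X : chain m A B) (Y : chain m A' B')
    (f : cmap X Y) (g : cmap Y X) :
  cmap_comp (cmap_newton f g) f = cmap_quad (cmap_comp g f) /\
  cmap_comp f (cmap_newton f g) = cmap_quad (cmap_comp f g).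
Proof.
elim: m A A' X Y f g => [|m IH] A A' X Y f g //=.
have [-> ->] := IH _ _ _ _ f.2 g.2.
by rewrite compBl compBr compDl compDr !compA.
Qed.

Lemma is_cmap_newton m A C A' C' (X : chain m A C) (Y : chain m A' C')
    (a : hom A A') (f : cmap X Y) (c : hom C C') (a' : hom A' A)
    (g : cmap Y X) (c' : hom C' C) :
  is_cmap a f c -> is_cmap a' g c' ->
  is_cmap (a' + a' - a' ∘ (a ∘ a')) (cmap_newton f g)
    (c' + c' - c' ∘ (c ∘ c')).
Proof.
elim: m A A' X Y a f a' g => [|m IH] A A' X Y a f a' g /=.
  move=> h h'; rewrite compBl compBr compDl compDr -!compA h'.
  by rewrite (compA c) h -(compA Y) (compA c') h' -!compA.
move=> [h hf] [h' hg]; split; last exact: IH.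
rewrite compBl compBr compDl compDr -!compA h'.
by rewrite (compA f.1) h -(compA (arr Y)) (compA g.1) h' -!compA.
Qed.

(* The square of u = f - 1 is null-homotopic: if psi contracts u away from the
   left end, then u psi contracts u^2 everywhere. *)
Lemma homotopic_quad m A C (X : chain m A C) (a : hom A A) (f : cmap X X) :
  is_complex X -> (forall W, cov_exact W X) -> is_cmap a f (idm C) ->
  exists psi : hom (target X) A,
    let w := a - idm A - psi ∘ first_arr X in
    first_arr X ∘ w = 0 /\
    homotopic_from (- ((a - idm A) ∘ w)) (a + a - a ∘ a) (cmap_quad f)
      (idm C) (idm A) (cmap_id X) (idm C).
Proof.
have sq (B : T) (b : hom B B) :
    - ((b - idm B) ∘ (b - idm B)) = b + b - b ∘ b - idm B.
  rewrite !compBl !compBr !comp1m !compm1 !opprB addrACA.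
  by rewrite [- _ - _]addrC addrA.
elim: m A X a f => [|m IH] A X a f /=.
  move=> _ _; rewrite comp1m => e; exists 0; rewrite comp0m subr0.
  split; first by rewrite compBr compm1 -e subrr.
  by exists 0; rewrite comp0m addr0 compm0 subrr -sq.
move=> [e cX] hX [h1 h2].
have [psi2 [e2 H]] := IH _ _ _ _ cX (fun W => (hX W).2) h2.
have [psi e1] := ((hX _).1 _).1 e2.
exists psi; split.
  rewrite !compBr -h1 compm1 compA e1 !compBl -compA e compm0 subr0 comp1m.
  exact: subrr.
exists (- ((a - idm A) ∘ psi)); split.
  by rewrite -sq !compNl -opprD -!compA -compDr subrK.
suff -> : arr X ∘ - ((a - idm A) ∘ psi) =
    - ((f.1 - idm _) ∘ (f.1 - idm _ - psi2 ∘ first_arr (tail X))) by [].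
by rewrite -e1 compNr !compA; congr (- (_ ∘ _)); rewrite compBr compBl h1
  compm1 comp1m.
Qed.

(** The given [g] need not invert [f] up to homotopy, so it is replaced by its Newton correction,
    whose ends are still identities as 1 + 1 - 1 = 1. With identity ends the starting term in
    [homotopic_quad] vanishes, which makes it a genuine homotopy. *)
Lemma homotopy_equivalentP m A C (X Y : chain m A C) (f : cmap X Y)
    (g : cmap Y X) :
  is_complex X -> is_complex Y ->
  (forall W, cov_exact W X) -> (forall W, cov_exact W Y) ->
  is_cmap (idm A) f (idm C) -> is_cmap (idm A) g (idm C) ->
  homotopy_equivalent X Y.
Proof.
move=> cX cY hX hY hf hg.
have one (B : T) : idm B + idm B - idm B ∘ idm B = idm B.
  by rewrite comp1m addrK.
have hq (Z : chain m A C) (u : cmap Z Z) : is_complex Z ->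
    (forall W, cov_exact W Z) -> is_cmap (idm A) u (idm C) ->
    homotopic (idm A) (cmap_quad u) (idm C) (idm A) (cmap_id Z) (idm C).
  move=> cZ hZ hu; have [psi /= [_]] := homotopic_quad cZ hZ hu.
  by rewrite subrr comp0m oppr0 one.
exists f, (cmap_newton f g); split=> //.
- by have := is_cmap_newton hf hg; rewrite !comp1m !addrK.
- rewrite (cmap_newton_comp f g).1; apply: hq => //.
  by have := is_cmap_comp hf hg; rewrite !comp1m.
- rewrite (cmap_newton_comp f g).2; apply: hq => //.
  by have := is_cmap_comp hg hf; rewrite !comp1m.
Qed.

Lemma homotopic_from_first m A B A' B' (X : chain m A B) (Y : chain m A' B')
    (e a a' : hom A A') (f g : cmap X Y) (b b' : hom B B') :
  homotopic_from e a f b a' g b' ->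
  exists phi : hom (target X) A', a - a' = e + phi ∘ first_arr X.
Proof. by case: m X Y f g => [|m] X Y f g /= [phi [h _]]; exists phi. Qed.

(** [Y] is a homotopy retract of [X]: a cycle [v] of [Y] is sent to [X], bounded there by [g] and
    brought back, and the homotopy accounts for the difference between [p q v] and [v]. The term [e]
    is free for the induction. *)
Lemma cov_exact_homotopic m A C A' C' (X : chain m A C) (Y : chain m A' C')
    (a : hom A A') (p : cmap X Y) (c : hom C C') (a' : hom A' A)
    (q : cmap Y X) (c' : hom C' C) (e : hom A' A') W :
  is_complex Y -> is_cmap a p c -> is_cmap a' q c' ->
  homotopic_from e (a ∘ a') (cmap_comp p q) (c ∘ c') (idm A') (cmap_id Y)
    (idm C') ->
  cov_exact W X -> cov_exact W Y.
Proof.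
elim: m A A' X Y a p a' q e => [|m IH] A A' X Y a p a' q e //=.
move=> [dY cY] [hp hp'] [hq hq'] [phi [_ H]] [hX hX'].
split; last exact: IH cY hp' hq' H hX'.
move=> v; split=> [hv|[u <-]]; last by rewrite compA dY comp0m.
have [g eg] : exists g, arr X ∘ g = q.1 ∘ v.
  apply/hX; rewrite compA -(cmap_firstP hq') -compA hv compm0 //.
have [phi2 e2] := homotopic_from_first H.
exists (a ∘ g - phi ∘ v).
have := congr1 (fun x => x ∘ v) e2.
rewrite compBl comp1m compDl -!compA hv compm0 addr0 -eg.
rewrite compBr !compA hp -!compA => <-.
by rewrite opprB addrCA subrr addr0.
Qed.

Lemma is_complex_snoc m A B C (X : chain m A B) (h : hom B C) :
  is_complex (snoc X h) <-> is_complex X /\ h ∘ last_arr X = 0.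
Proof.
elim: m A X => [|m IH] A X /=; first by split=> [[]|[]].
have e : first_arr (snoc (tail X) h) = first_arr (snoc (tail X) h) by [].
split.
  case: m IH X e => [|m] IH X e /= [h1 h2].
    by move: h2 => [h2 _].
  by have [] := (IH _ (tail X)).1 h2.
case: m IH X e => [|m] IH X e /= [[h1 h2] h3]; first by split.
by split=> //; apply/(IH _ (tail X)).
Qed.

Lemma cov_exact_snoc W m A B C (X : chain m A B) (h : hom B C) :
  cov_exact W (snoc X h) <-> cov_exact W X /\
    exact_at (fun f : hom W (source X) => last_arr X ∘ f)
             (fun f : hom W B => h ∘ f).
Proof.
elim: m A X => [|m IH] A X /=; first by split=> [[]|[]].
case: m IH X => [|m] IH X /=; first by split; [case=> ? []|case=> [[]]].
split=> [[h1 /(IH _ (tail X))[h2 h3]] //|[[h1 h2] h3]].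
by split=> //; apply/(IH _ (tail X)).
Qed.

(** For a variable length, [source (snoc X h)] is not convertible to [B]; morphisms into one are
    traded for morphisms into the other with the same composite to [C]. *)
Lemma last_snoc m A B C (X : chain m A B) (h : hom B C) V
    (y : hom V (source (snoc X h))) :
  exists y' : hom V B, last_arr (snoc X h) ∘ y = h ∘ y'.
Proof.
by elim: m A X y => [|m IH] A X y /=; [exists y | exact: IH].
Qed.

Lemma snoc_last m A B C (X : chain m A B) (h : hom B C) V (y : hom V B) :
  exists y' : hom V (source (snoc X h)), last_arr (snoc X h) ∘ y' = h ∘ y.
Proof.
by elim: m A X => [|m IH] A X /=; [exists y | exact: IH].
Qed.

Lemma snocP m A C (X : chain m.+1 A C) :
  exists (B : T) (X' : chain m A B) (h : hom B C), X = snoc X' h.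
Proof.
elim: m A X => [|m IH] A [X1 d X'] /=; first by exists X1, d, X'.
have [B [Y [h ->]]] := IH _ X'.
by exists B, (Step X1 d Y), h.
Qed.

Lemma is_cmap_snoc m A B C A' B' C' (X : chain m A B) (h : hom B C)
    (Y : chain m A' B') (h' : hom B' C') (a : hom A A') (c : hom C C')
    (f : cmap (snoc X h) (snoc Y h')) :
  is_cmap a f c ->
  exists (g : cmap X Y) (b : hom B B'), is_cmap a g b /\ c ∘ h = h' ∘ b.
Proof.
elim: m A A' X Y a f => [|m IH] A A' X Y a f /=.
  by move=> [h1 h2]; exists tt, f.1.
move=> [h1 /IH[g [b [h2 h3]]]]; exists (f.1, g), b; split=> //; by split.
Qed.

End ChainMaps.

(** * Mapping cones *)

Section Cones.
Variable T : additiveCat.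
Implicit Types A B C D F V W : T.

Lemma cone_from_eq m A B C D F (X : chain m A C) (Y : chain m B D)
    (f : cmap X Y) (l l' : forall V, hom V D -> hom (C ⊕ V) F) :
  (forall V d, l V d = l' V d) -> cone_from f l = cone_from f l'.
Proof.
move=> e; elim: m A B X Y f => [|m IH] A B X Y f /=; first exact: e.
by rewrite IH.
Qed.

Lemma cone_from_map m A B C D F A' B' C' D' F' (X : chain m A C)
    (Y : chain m B D) (X' : chain m A' C') (Y' : chain m B' D')
    (f : cmap X Y) (f' : cmap X' Y')
    (l : forall V, hom V D -> hom (C ⊕ V) F)
    (l' : forall V, hom V D' -> hom (C' ⊕ V) F')
    (a : hom A A') (g : cmap X X') (c : hom C C')
    (b : hom B B') (h : cmap Y Y') (d : hom D D') (w : hom F F') :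
  is_cmap a g c -> is_cmap b h d -> cmap_comp h f = cmap_comp f' g ->
  (forall V V' (y : hom V D) (y' : hom V' D') (v : hom V V'),
     y' ∘ v = d ∘ y -> l' V' y' ∘ blockm c 0 0 v = w ∘ l V y) ->
  exists i : cmap (cone_from f l) (cone_from f' l'),
    is_cmap (blockm (cmap_first g c) 0 0 b) i w.
Proof.
move=> + + + hl.
elim: m A B A' B' X Y X' Y' f f' a g b h =>
  [|m IH] A B A' B' X Y X' Y' f f' a g b h /=.
  by move=> _ e _; exists tt; rewrite (hl _ _ Y Y' b).
move=> [h1 h2] [h3 h4] [e1 e2].
have [i hi] := IH _ _ _ _ _ _ _ _ _ _ _ _ _ _ h2 h4 e2.
exists (blockm (cmap_first g.2 c) 0 0 h.1, i); split=> //=.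
rewrite !blockm_blockm !comp0m !compm0 !addr0 !add0r e1 h3.
by rewrite compNr compNl (cmap_firstP h2).
Qed.

Lemma cone_map m A C D A' C' D' (X : chain m.+1 A C)
    (Y : chain m.+1 A D) (X' : chain m.+1 A' C') (Y' : chain m.+1 A' D')
    (f : cmap X Y) (f' : cmap X' Y') (x : hom C D) (x' : hom C' D')
    (a : hom A A') (g : cmap X X') (c : hom C C')
    (b : hom A A') (h : cmap Y Y') (d : hom D D') :
  is_cmap a g c -> is_cmap b h d -> cmap_comp h f = cmap_comp f' g ->
  x' ∘ c = d ∘ x ->
  exists i : cmap (cone f x) (cone f' x'), is_cmap g.1 i d.
Proof.
move=> /= [h1 h2] [h3 h4] [e1 e2] ex.
have [] := @cone_from_map m _ _ _ _ D _ _ _ _ D' _ _ _ _ f.2 f'.2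
  (fun V y => rowm x y) (fun V y => rowm x' y) _ g.2 c _ h.2 d d h2 h4 e2.
  move=> V V' y y' v e; rewrite rowm_blockm comp_rowm !compm0 addr0 add0r.
  by rewrite ex e.
move=> i hi; exists (blockm (cmap_first g.2 c) 0 0 h.1, i); split=> //=.
rewrite blockm_colm colm_comp !comp0m addr0 add0r e1.
by rewrite compNr compNl (cmap_firstP h2).
Qed.

Lemma is_complex_cone_from m A B C D (X : chain m A C) (Y : chain m B D)
    (u : hom A B) (f : cmap X Y) (c : hom C D) :
  is_complex X -> is_complex Y -> is_cmap u f c ->
  is_complex (cone_from f (fun V y => rowm c y)).
Proof.
elim: m A B X Y u f => [|m IH] A B X Y u f //= [dX cX] [dY cY] [h1 h2].
split; last exact: IH cX cY h2.
case: m {IH} X Y f dX cX dY cY h1 h2 => [|m] X Y f /=.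
  move=> dX cX dY cY h1 h2; rewrite rowm_blockm.
  by rewrite compNr h2 addNr compm0 dY addr0; apply: rowm_ext;
    rewrite ?rowm_in1 ?rowm_in2 comp0m.
move=> dX [dX2 cX] dY cY h1 [h2 h3]; rewrite blockm_blockm.
rewrite !compNl !compNr dX2 h2 !comp0m !compm0 dY !addr0 !oppr0 addNr.
by apply: rowm_ext; rewrite ?blockm_in1 ?blockm_in2 comp0m;
  apply: colm_ext; rewrite ?pr1_colm ?pr2_colm compm0.
Qed.

(** For a cycle [v] of the cone, the first coordinate is bounded in [X], and what remains of the
    second is a cycle of [Y]. At the last place [X] has no further differential; the hypothesis on
    [c ∘ x = last_arr Y ∘ y] stands in for exactness at its end term. *)
Lemma cov_exact_cone_from W m A B C D (X : chain m A C) (Y : chain m B D)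
    (u : hom A B) (f : cmap X Y) (c : hom C D) :
  is_complex X -> is_complex Y -> cov_exact W X -> cov_exact W Y ->
  (forall (x : hom W C) (y : hom W (source Y)), c ∘ x = last_arr Y ∘ y ->
     exists x', x = last_arr X ∘ x') ->
  is_cmap u f c ->
  cov_exact W (cone_from f (fun V y => rowm c y)).
Proof.
elim: m A B X Y u f => [|m IH] A B X Y u f //= cX cY [_ eX] [eY eY'] eC h.
have := is_complex_cone_from (X := X) (Y := Y) cX cY h.
move: cX cY h => [dX cX] [dY cY] [h1 h2] [dK _].
split; last exact: IH eC h2.
move=> v; split=> [hv|[w <-]]; last by rewrite compA dK comp0m.
have [x' [e1 e2]] : exists x' : hom W (obj X),
    pr1 ∘ v = - first_arr (tail X) ∘ x' /\
    first_arr (tail Y) ∘ (pr2 ∘ v - f.1 ∘ x') = 0.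
  move: hv; rewrite {1}[v]colm_eta; clear IH dK.
  case: m X Y f dX cX dY cY h1 h2 eX eY eY' eC v
    => [|m] X Y f /= dX cX dY cY h1 h2 eX eY eY' eC v.
    rewrite rowm_colm => hv.
    have [|x' ex] := eC (pr1 ∘ v) (- (pr2 ∘ v)).
      by apply/eqP; rewrite compNr -addr_eq0 hv.
    exists (- x'); split; first by rewrite compNl compNr opprK.
    rewrite compBr !compA -h2 -!compA compNr -ex compNr opprK addrC; exact: hv.
  rewrite blockm_colm comp0m addr0 => hv.
  have [] := (eX.1 (pr1 ∘ v)).1.
    apply: oppr_inj; rewrite oppr0 -compNl.
    by have := congr1 (fun z => pr1 ∘ z) hv; rewrite /= pr1_colm compm0.
  move=> x' ex; exists (- x'); split; first by rewrite compNl compNr opprK.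
  rewrite compBr !compA -h2.1 -!compA compNr ex compNr opprK addrC.
  by have := congr1 (fun z => pr2 ∘ z) hv; rewrite /= pr2_colm compm0.
have [y' ey] := (eY _).1 e2.
exists (colm x' y'); rewrite blockm_colm comp0m addr0 ey addrC subrK -e1.
exact: esym (colm_eta _).
Qed.

Lemma last_cone_from m A B C D (X : chain m A C) (Y : chain m B D)
    (f : cmap X Y) (c : hom C D) V
    (y : hom V (source (cone_from f (fun V y => rowm c y)))) :
  exists (u : hom V C) (v : hom V (source Y)),
    last_arr (cone_from f (fun V y => rowm c y)) ∘ y =
    c ∘ u + last_arr Y ∘ v.
Proof.
elim: m A B X Y f y => [|m IH] A B X Y f y /=; last exact: IH.
exists (pr1 ∘ y), (pr2 ∘ y); rewrite {1}[y]colm_eta rowm_colm //.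
Qed.

Lemma cone_from_last m A B C D (X : chain m A C) (Y : chain m B D)
    (f : cmap X Y) (c : hom C D) V (u : hom V C) (v : hom V (source Y)) :
  exists y : hom V (source (cone_from f (fun V y => rowm c y))),
    last_arr (cone_from f (fun V y => rowm c y)) ∘ y =
    c ∘ u + last_arr Y ∘ v.
Proof.
elim: m A B X Y f v => [|m IH] A B X Y f v /=; last exact: IH.
by exists (colm u v); rewrite rowm_colm.
Qed.

Lemma last_cone m A C D (X : chain m A C) (Y : chain m A D)
    (f : cmap X Y) (c : hom C D) V (y : hom V (source (cone f c))) :
  exists (u : hom V C) (v : hom V (source Y)),
    last_arr (cone f c) ∘ y = c ∘ u + last_arr Y ∘ v.
Proof.
case: m X Y f y => [|m] X Y f y /=; last exact: last_cone_from.
by exists y, 0; rewrite compm0 addr0.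
Qed.

(* [cone f c] and [cone_from f] differ only in their first term, X_1 against
   X_1 + Y_0; as f_0 = id, the first differential of the latter is that of the
   former composed with [id, d^X_0]. *)
Lemma cone_exact W m A C D (X : chain m.+1 A C) (Y : chain m.+1 A D)
    (f : cmap X Y) (c : hom C D) :
  is_complex X -> is_complex Y -> cov_exact W X -> cov_exact W Y ->
  (forall (x : hom W C) (y : hom W (source Y)), c ∘ x = last_arr Y ∘ y ->
     exists x', x = last_arr X ∘ x') ->
  is_cmap (idm A) f c ->
  is_complex (cone f c) /\ cov_exact W (cone f c).
Proof.
move=> cX cY eX eY eC h.
have [dK cK] := is_complex_cone_from cX cY h.
have [eK eK'] := cov_exact_cone_from cX cY eX eY eC h.
have eI : colm (- first_arr (tail X)) f.1 =
    blockm (- first_arr (tail X)) 0 f.1 (arr Y) ∘ in1 by rewrite blockm_in1.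
have dK' : first_arr (cone_from f.2 (fun V y => rowm c y)) ∘
    colm (- first_arr (tail X)) f.1 = 0 by rewrite eI compA dK comp0m.
split=> //; split=> // v; split=> [/eK[w <-]|[w <-]]; last first.
  by rewrite compA dK' comp0m.
exists (pr1 ∘ w + arr X ∘ (pr2 ∘ w)).
move: cX h => [dX _] [h1 _].
rewrite [w in RHS]colm_eta blockm_colm comp0m addr0 colm_comp !compDr.
by rewrite !compNl !compA dX !comp0m subr0 h1 compm1.
Qed.

End Cones.

(** * Realizations in a category with shift *)

Section Extensions.
Variables (T : additiveCat) (E : extBifunctor T).
Implicit Types A B C D : T.

Lemma push0l C A B (d : E C A) : push (0 : hom A B) d = 0.
Proof. by apply: (addrI (push 0 d)); rewrite -pushD !addr0. Qed.

Lemma pull0l C D A (d : E C A) : pull (0 : hom D C) d = 0.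
Proof. by apply: (addrI (pull 0 d)); rewrite -pullD !addr0. Qed.

Lemma pushNl C A B (f : hom A B) (d : E C A) : push (- f) d = - push f d.
Proof. by apply: (addrI (push f d)); rewrite -pushD !subrr push0l. Qed.

Lemma pullNl C D A (f : hom D C) (d : E C A) : pull (- f) d = - pull f d.
Proof. by apply: (addrI (pull f d)); rewrite -pullD !subrr pull0l. Qed.

Lemma pushMz C A B (f : hom A B) (z : int) (d : E C A) :
  push (f *~ z) d = push f d *~ z.
Proof.
have hn n : push (f *+ n) d = push f d *+ n.
  by elim: n => [|n IH]; rewrite ?mulr0n ?push0l // !mulrS pushD IH.
by case: z => n; rewrite ?NegzE ?mulrNz -!pmulrn ?pushNl hn.
Qed.

Lemma pullMz C D A (f : hom D C) (z : int) (d : E C A) :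
  pull (f *~ z) d = pull f d *~ z.
Proof.
have hn n : pull (f *+ n) d = pull f d *+ n.
  by elim: n => [|n IH]; rewrite ?mulr0n ?pull0l // !mulrS pullD IH.
by case: z => n; rewrite ?NegzE ?mulrNz -!pmulrn ?pullNl hn.
Qed.

End Extensions.

(* The covariant half of an n-exangle. *)
Record is_covangle (T : additiveCat) (E : extBifunctor T) (n : nat) (A C : T)
    (Z : chain n A C) (d : E C A) : Prop := IsCovangle {
  cov_complex : is_complex Z;
  cov_push : push (first_arr Z) d = 0;
  cov_pull : pull (last_arr Z) d = 0;
  cov_mid : forall W, cov_exact W Z;
  cov_right : forall W (y : hom W C), pull y d = 0 ->
    exists g, y = last_arr Z ∘ g
}.

(* What is needed of the induced realization in the stable category.  In
   [real_EA2] and [real_EA2op] only some complexes X and Y are involved: a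
   representative of a stable class need not come from a distinguished
   n-exangle. *)
Record is_cov_realization (T : additiveCat) (E : extBifunctor T) (k : nat)
    (s : assignment E k.+1) : Prop := IsCovRealization {
  real_ex : forall A C (d : E C A), exists Z, s C A d Z;
  real_lift : forall A B C D (d : E C A) (r : E D B)
      (X : chain k.+1 A C) (Y : chain k.+1 B D) (a : hom A B) (c : hom C D),
    s _ _ d X -> s _ _ r Y -> push a d = pull c r ->
    exists f : cmap X Y, is_cmap a f c;
  real_cov : forall A C (d : E C A) Z, s _ _ d Z -> is_covangle Z d;
  real_push : forall A C (d : E C A) Z, s _ _ d Z ->
    forall W (x : E W A), push (first_arr Z) x = 0 ->
    exists g : hom W C, x = pull g d;
  real_contra : forall A C (d : E C A) (Z : chain k.+1 A C), s _ _ d Z ->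
    forall W (g : hom (obj Z) W), g ∘ arr Z = 0 ->
    exists h, g = h ∘ first_arr (tail Z);
  real_crit : forall A C (d : E C A) (W Z : chain k.+1 A C),
    is_complex Z -> (forall V, cov_exact V Z) -> s _ _ d W ->
    (exists f : cmap Z W, is_cmap (idm A) f (idm C)) ->
    (exists f : cmap W Z, is_cmap (idm A) f (idm C)) -> s _ _ d Z;
  real_id_left : forall A, s zob A 0 (id_left k.+1 A);
  real_EA2 : forall A C D (r : E D A) (c : hom C D),
    exists (X : chain k.+1 A C) (Y : chain k.+1 A D) (f : cmap X Y),
      [/\ s _ _ (pull c r) X, s _ _ r Y, is_cmap (idm A) f c
        & s _ _ (push (arr X) r) (cone f c)];
  real_EA2op : forall A B C (d : E C A) (a : hom A B),
    exists (X : chain k.+1 A C) (Y : chain k.+1 B C) (f : cmap X Y),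
      [/\ s _ _ d X, s _ _ (push a d) Y, is_cmap a f (idm C)
        & s _ _ (pull (last_arr Y) d) (cocone a f)]
}.

(** Through [dl A], the functor E(-, A) is represented by [S A] and E(S A, -) by [A]. Comparing the
    two gives that [S] is fully faithful, and [shift_ess] adds essential surjectivity. *)
Record is_shift (T : additiveCat) (E : extBifunctor T) (S : functorData T T)
    (dl : forall A : T, E (S A) A) : Prop := IsShift {
  shift_nat : forall A B (f : hom A B), push f (dl A) = pull (fmap S f) (dl B);
  shift_pull_inj : forall A C (h : hom C (S A)), pull h (dl A) = 0 -> h = 0;
  shift_pull_surj : forall A C (d : E C A), exists h, d = pull h (dl A);
  shift_push_inj : forall A B (f : hom A B), push f (dl A) = 0 -> f = 0;
  shift_push_surj : forall A B (d : E (S A) B), exists f, d = push f (dl A);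
  shift_ess : forall C, exists (B : T) (u : hom C (S B)) (v : hom (S B) C),
    v ∘ u = idm C /\ u ∘ v = idm (S B)
}.

Section Shift.
Variables (T : additiveCat) (E : extBifunctor T) (S : functorData T T).
Variable dl : forall A : T, E (S A) A.
Hypothesis hS : is_shift dl.
Implicit Types A B C D : T.

Lemma shift_pull_eq A C (h h' : hom C (S A)) :
  pull h (dl A) = pull h' (dl A) -> h = h'.
Proof.
move=> e; apply/eqP; rewrite -subr_eq0; apply/eqP/(shift_pull_inj hS).
by rewrite pullD pullNl e subrr.
Qed.

Lemma shift_push_eq A B (f f' : hom A B) :
  push f (dl A) = push f' (dl A) -> f = f'.
Proof.
move=> e; apply/eqP; rewrite -subr_eq0; apply/eqP/(shift_push_inj hS).
by rewrite pushD pushNl e subrr.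
Qed.

Lemma shift_is_functor : is_functor S.
Proof.
split=> [A|A B C g f]; apply: shift_pull_eq.
  by rewrite -(shift_nat hS) push_id pull_id.
by rewrite pull_comp -!(shift_nat hS) push_comp -push_pull -!(shift_nat hS).
Qed.

Lemma shift_faithful A B (f g : hom A B) : fmap S f = fmap S g -> f = g.
Proof. by move=> e; apply: shift_push_eq; rewrite !(shift_nat hS) e. Qed.

Lemma shift_full A B (g : hom (S A) (S B)) : exists f, g = fmap S f.
Proof.
have [f e] := shift_push_surj hS (pull g (dl B)).
by exists f; apply: shift_pull_eq; rewrite e (shift_nat hS).
Qed.

Lemma shift_autoequivalence : is_autoequivalence S.
Proof.
have [S1 SM] := shift_is_functor.
split=> //.
pose b C := projT1 (cid (shift_ess hS C)).
have bP C : exists (u : hom C (S (b C))) (v : hom (S (b C)) C),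
    v ∘ u = idm C /\ u ∘ v = idm (S (b C)) := projT2 (cid (shift_ess hS C)).
pose u C := projT1 (cid (bP C)).
pose v C := projT1 (cid (projT2 (cid (bP C)))).
have vu C : v C ∘ u C = idm C := (projT2 (cid (projT2 (cid (bP C))))).1.
have uv C : u C ∘ v C = idm (S (b C)) :=
  (projT2 (cid (projT2 (cid (bP C))))).2.
pose g C D (f : hom C D) := projT1 (cid (shift_full (u D ∘ f ∘ v C))).
have gP C D (f : hom C D) : fmap S (g C D f) = u D ∘ f ∘ v C :=
  esym (projT2 (cid (shift_full (u D ∘ f ∘ v C)))).
exists (@FunctorData T T b g); split.
- split=> [A|A B C h f]; apply: shift_faithful.
    by rewrite gP S1 compm1 uv.
  by rewrite SM !gP -!compA (compA (v B)) vu comp1m !compA.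
- have pP A := cid (shift_full (u (S A))).
  have qP A := cid (shift_full (v (S A))).
  exists (fun A => projT1 (qP A)), (fun A => projT1 (pP A)).
  split=> [A|A|A B f]; apply: shift_faithful; rewrite /= ?SM ?S1.
  + by rewrite -(projT2 (qP A)) -(projT2 (pP A)) uv.
  + by rewrite -(projT2 (qP A)) -(projT2 (pP A)) vu.
  + by rewrite -!(projT2 (qP _)) gP !compA vu comp1m.
- exists v, u; split=> // A B f /=.
  by rewrite gP !compA vu comp1m.
Qed.

End Shift.

(** * Criteria for realizing an extension; cones between arbitrary representatives *)

Section MappingCones.
Variables (T : additiveCat) (E : extBifunctor T) (k : nat).
Variables (s : assignment E k.+1) (S : functorData T T).
Variable dl : forall A : T, E (S A) A.
Hypotheses (hs : is_cov_realization s) (hS : is_shift dl).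
Implicit Types A B C D V W : T.

(* The map constructed from the right has some left end w0; w0 - 1 is a multiple
   of d_0 up to kappa with d_0 kappa = 0, and exactness at A, seen after S, shows
   that kappa is also killed by the first arrow of Q. *)
Lemma cmap_back A C (P Q : chain k.+1 A C) (d : E C A) (g : cmap Q P) :
  is_covangle P d -> is_covangle Q d ->
  (forall f : hom A A, first_arr P ∘ f = 0 ->
     exists h : hom (S A) C, push f (dl A) = pull h d) ->
  is_cmap (idm A) g (idm C) -> exists f : cmap P Q, is_cmap (idm A) f (idm C).
Proof.
move=> hP hQ hA hg.
have [y ey] := cov_right hQ (cov_pull hP).
have [w0 [w hw]] : exists (w0 : hom A A) (w : cmap P Q), is_cmap w0 w (idm C).
  apply: cmap_lift_right (cov_complex hP) (cov_mid hQ) _.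
  by exists y; rewrite comp1m.
have := is_cmap_comp hw hg; rewrite !comp1m => hgw.
have [psi e] := homotopy_right (cov_complex hP) (cov_mid hP) hgw (is_cmap_id P).
have [h eh] := hA _ e.
set kappa := w0 - _ - _ in e eh.
have e0 : first_arr Q ∘ kappa = 0.
  apply: (shift_push_inj hS).
  by rewrite push_comp eh push_pull (cov_push hQ) raddf0.
have hw' : is_cmap (w0 - kappa) w (idm C).
  by apply: is_cmap_start hw; rewrite compBr e0 subr0.
have [f hf] := cmap_shift_left psi (cov_complex hQ) hw'.
exists f; move: hf; suff -> : w0 - kappa - psi ∘ arr P = idm A by [].
rewrite /kappa /= !opprB addrCA [X in X = _]addrC addKr.
by rewrite [X in X = _]addrC subrK.
Qed.

(** Exactness at the left end term, one place beyond the covariant Hom sequences: the morphism [f]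
    is encoded as the extension [push f (dl V)], to which [real_push] applies. *)
Lemma real_first_kernel A C (d : E C A) Z V (f : hom V A) : s d Z ->
  first_arr Z ∘ f = 0 -> exists h : hom (S V) C, push f (dl V) = pull h d.
Proof.
move=> sZ e; apply: (real_push hs sZ).
by rewrite -push_comp e push0l.
Qed.

Lemma real_of_map A C (d : E C A) (Z W : chain k.+1 A C) (f : cmap Z W) :
  is_covangle Z d -> s d W -> is_cmap (idm A) f (idm C) -> s d Z.
Proof.
move=> hZ sW hf; apply: (real_crit hs (cov_complex hZ) (cov_mid hZ) sW).
  by exists f.
by apply: (cmap_back (real_cov hs sW) hZ _ hf) => g; exact: real_first_kernel.
Qed.

(** The map to be constructed now starts at [Z], which is not yet known to realize [d], so the
    kernel condition at [A] has to be supplied; for [real_of_map] it comes from [W]. *)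
Lemma real_of_map_from A C (d : E C A) (Z W : chain k.+1 A C) (f : cmap W Z) :
  is_covangle Z d ->
  (forall f : hom A A, first_arr Z ∘ f = 0 ->
     exists h : hom (S A) C, push f (dl A) = pull h d) ->
  s d W -> is_cmap (idm A) f (idm C) -> s d Z.
Proof.
move=> hZ hA sW hf.
have [g hg] := cmap_back hZ (real_cov hs sW) hA hf.
exact: real_of_map hZ sW hg.
Qed.

(** A realization of [dl A] has zero first and last arrows, because both kill [dl A] and such
    morphisms vanish. Hence the identities on the ends with zeros in between form a chain map into
    it. *)
Lemma real_zero_chain A : s (dl A) (zero_chain k.+1 A (S A)).
Proof.
have [W sW] := real_ex hs (dl A).
have hW := real_cov hs sW.
have dW0 : first_arr W = 0 by apply: (shift_push_inj hS); exact: cov_push hW.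
have dW1 : last_arr W = 0 by apply: (shift_pull_inj hS); exact: cov_pull hW.
have last0 m B D : last_arr (zero_chain m B D) = 0 :> hom (_ : T) _.
  by elim: m B => [|m IH] B //=; exact: IH.
have first0 m B D : first_arr (zero_chain m B D) = 0 :> hom (_ : T) _.
  by case: m.
have cX m B D : is_complex (zero_chain m B D : chain (T := T) m B D).
  elim: m B => [|m IH] B //=; split; last exact: IH.
  by rewrite compm0.
have eX m V D : cov_exact V (zero_chain m zob D : chain (T := T) m zob D).
  elim: m => [|m IH] //=; split=> // v; split=> _.
    by exists 0; rewrite (to_zob v) comp0m.
  by rewrite (to_zob v) compm0.
have [f hf] : exists f : cmap (zero_chain k.+1 A (S A)) W,
    is_cmap (idm A) f (idm (S A)).
  have hm m B B' D (X : chain m B' D) (a : hom B B') : first_arr X ∘ a = 0 ->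
      last_arr X = 0 -> is_complex X ->
      exists f : cmap (zero_chain m B D) X, is_cmap a f (idm D).
    elim: m B B' X a => [|m IH] B B' X a /=.
      by move=> e _ _; exists tt; rewrite e compm0.
    move=> e e' [_ cX'].
    have [|f hf] := IH zob _ (tail X) 0 _ e' cX'; first by rewrite compm0.
    by exists (0, f); split=> //=; rewrite e comp0m.
  by apply: hm (cov_complex hW); rewrite // dW0 comp0m.
apply: real_of_map sW hf; split.
- exact: cX.
- by rewrite first0 push0l.
- by rewrite last0 pull0l.
- move=> V; split=> [v|]; last exact: eX.
  split=> _; first by exists 0; rewrite (to_zob v) comp0m.
  by rewrite (to_zob v) compm0.
- by move=> V y /(shift_pull_inj hS) ->; exists 0; rewrite compm0.
Qed.

Lemma covangle_cone A C D (r : E D A) (c : hom C D) (X : chain k.+1 A C)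
    (Y : chain k.+1 A D) (f : cmap X Y) :
  s (pull c r) X -> s r Y -> is_cmap (idm A) f c ->
  is_covangle (cone f c) (push (arr X) r).
Proof.
move=> sX sY hf; have hX := real_cov hs sX; have hY := real_cov hs sY.
have [cX cY] := (cov_complex hX, cov_complex hY).
have eC V (x : hom V C) (y : hom V (source Y)) : c ∘ x = last_arr Y ∘ y ->
    exists x', x = last_arr X ∘ x'.
  move=> e; apply: (cov_right hX).
  by rewrite -pull_comp e pull_comp (cov_pull hY) raddf0.
have hK V := cone_exact cX cY (cov_mid hX V) (cov_mid hY V) (@eC V) hf.
split.
- exact: (hK zob).1.
- rewrite -push_comp; move: cX hf => [dX _] [h1 _] /=.
  rewrite colm_comp compNl dX h1 compm1 /colm oppr0 compm0 add0r.
  by rewrite push_comp (cov_push hY) raddf0.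
- rewrite -push_pull -[last_arr _]compm1.
  have [u [v ->]] := last_cone (idm (source (cone f c))).
  rewrite pullD !pull_comp (cov_pull hY) raddf0 addr0 push_pull.
  by rewrite (cov_push hX) raddf0.
- by move=> V; exact: (hK V).2.
(* If [y] kills the pushed extension, then [pull y r] is killed by [arr X] and so equals
   [pull (c ∘ g) r] for some [g]; the difference [y - c ∘ g] factors through the last arrow of
   [Y]. *)
- move=> V y; rewrite -push_pull => /(real_push hs sX)[g].
  rewrite -pull_comp => e.
  have [|z ez] := cov_right hY (y := y - c ∘ g).
    by rewrite pullD pullNl e subrr.
  have [w ew] := cone_from_last f.2 c g z.
  by exists w; rewrite [LHS](esym (subrK (c ∘ g) y)) addrC ez -ew.
Qed.

(** [real_EA2] speaks of some pair [X'], [Y'] only. The passage to the given pair is made in two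
    stages, first from [X'] to [X] and then from [Y'] to [Y], the cone being compared each time. *)
Lemma real_cone A C D (r : E D A) (c : hom C D) (X : chain k.+1 A C)
    (Y : chain k.+1 A D) :
  s (pull c r) X -> s r Y ->
  exists f : cmap X Y, is_cmap (idm A) f c /\ s (push (arr X) r) (cone f c).
Proof.
move=> sX sY; have [X' [Y' [f' [sX' sY' hf' sK']]]] := real_EA2 hs r c.
have id_lift B F (d : E F B) Z Z' : s d Z -> s d Z' ->
    exists f : cmap Z Z', is_cmap (idm B) f (idm F).
  by move=> sZ sZ'; apply: (real_lift hs sZ sZ'); rewrite push_id pull_id.
have [q hq] := id_lift _ _ _ _ _ sX sX'.
have [p hp] := id_lift _ _ _ _ _ sX' sX.
have [p' hp'] := id_lift _ _ _ _ _ sY' sY.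
have comp_id m B F B' F' (Z : chain m B F) (Z' : chain m B' F')
    (u : cmap Z Z') : cmap_comp (cmap_id Z') u = u /\
    cmap_comp u (cmap_id Z) = u.
  elim: m B B' Z Z' u => [|m IH] B B' Z Z' [] //= u1 u2.
  by have [-> ->] := IH _ _ _ _ u2; rewrite comp1m compm1.
have hf1 := is_cmap_comp hq hf'; rewrite comp1m compm1 in hf1.
have hf2 := is_cmap_comp hf1 hp'; rewrite !comp1m in hf2.
have hK1 := covangle_cone sX sY' hf1.
have sK1 : s (push (arr X) r) (cone (cmap_comp f' q) c).
  have [i hi] : exists i : cmap (cone (cmap_comp f' q) c) (cone f' c),
      is_cmap q.1 i (idm D).
    apply: cone_map hq (is_cmap_id Y') _ _; last by rewrite comp1m compm1.
    by have [-> _] := comp_id _ _ _ _ _ _ _ (cmap_comp f' q).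
  have [W sW] := real_ex hs (push (arr X) r).
  have [j hj] : exists j : cmap (cone f' c) W, is_cmap p.1 j (idm D).
    apply: (real_lift hs sK' sW); rewrite pull_id -push_comp hp.1 compm1 //.
  have hji := is_cmap_comp hi hj; rewrite comp1m in hji.
  (* [p.1 ∘ q.1] is the identity only on the image of [arr X], so its difference from the identity
     has the form [t ∘ d_1]. The first arrow of the cone has [- d_1] as its first coordinate, so the
     homotopy [- t ∘ pr1] removes this difference. *)
  have [|t et] := real_contra hs sX (g := p.1 ∘ q.1 - idm _).
    by rewrite compBl -compA hq.1 compm1 hp.1 compm1 comp1m subrr.
  have [w hw] := cmap_shift_left (X := cone (cmap_comp f' q) c) (- t ∘ pr1)
    (cov_complex (real_cov hs sW)) hji.
  apply: (real_of_map hK1 sW (f := w)).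
  move: hw; rewrite /= -compA pr1_colm compNl compNr opprK -et.
  by rewrite opprB addrC subrK.
exists (cmap_comp p' (cmap_comp f' q)); split=> //.
have [i hi] : exists i : cmap (cone (cmap_comp f' q) c)
    (cone (cmap_comp p' (cmap_comp f' q)) c), is_cmap (idm _) i (idm D).
  apply: (cone_map (is_cmap_id X) hp'); last by rewrite comp1m compm1.
  by have [_ ->] := comp_id _ _ _ _ _ _ _ (cmap_comp p' (cmap_comp f' q)).
(* The comparison leaves the realized cone, so the kernel condition must be checked on the new one:
   a morphism killed by [[-d_1; f_1]] comes from some [g'] into [A], and [g'] is killed by
   [arr Y]. *)
apply: real_of_map_from (covangle_cone sX sY hf2) _ sK1 hi => g /= eg.
have e1 : first_arr (tail X) ∘ g = 0.
  have := congr1 (fun z => pr1 ∘ z) eg.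
  rewrite /= compA pr1_colm compm0 compNl => e.
  by apply: oppr_inj; rewrite oppr0.
have [g' eg'] := ((cov_mid (real_cov hs sX) _).1 _).1 e1.
have [|h eh] := real_first_kernel (f := g') sY.
  have := congr1 (fun z => pr2 ∘ z) eg.
  rewrite /= compA pr2_colm compm0 -eg' [_ ∘ (arr X ∘ g')]compA => e2.
  by move: hf2 => [/= h1 _]; move: e2; rewrite h1 compm1.
by exists h; rewrite -eg' push_comp eh push_pull.
Qed.

End MappingCones.

Lemma sign_mulz (V : zmodType) (x : V) (n : nat) :
  x *~ (-1) ^+ n *~ (-1) ^+ n = x.
Proof. by rewrite -mulrzA -expr2 sqrr_sign. Qed.

(** * Rotation and its signs *)

Section Signs.
Variable T : additiveCat.
Implicit Types A B C D V : T.

Lemma first_snoc m A B C (X : chain m A B) (h : hom B C) V (x : hom V A) :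
  first_arr (snoc X h) ∘ x = 0 <-> first_arr X ∘ x = 0.
Proof. by case: m X. Qed.

(** The cone of a map to a zero chain is the rest of [X] followed by [c], but with differentials
    [- d]. The comparison therefore alternates in sign; [z] lets the initial sign vary in the
    induction. *)
Lemma rotate_to_cone_from m A B C D (X : chain m A C)
    (f : cmap X (zero_chain m B D)) (c : hom C D) (z : int) :
  exists g : cmap (rotate_chain X c) (cone_from f (fun V y => rowm c y)),
    is_cmap (in1 *~ z) g (idm D *~ (z * (-1) ^+ m)).
Proof.
elim: m A B X f z => [|m IH] A B X f z /=.
  by exists tt; rewrite compMzl compMzr comp1m rowm_in1 expr0 mulr1.
have [g hg] := IH _ _ (tail X) f.2 (- z).
move: hg; rewrite exprS mulN1r mulrN -mulNr => hg.
have e : in1 *~ - z ∘ first_arr (tail X) =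
    blockm (- first_arr (tail X)) 0 f.1 (0 : hom B zob) ∘ (in1 *~ z).
  rewrite compMzl compMzr blockm_in1 (to_zob f.1) /colm compm0 addr0 compNr.
  by rewrite mulrNz mulNrz.
case: m {IH} X f g hg e => [|m] X f g hg e.
  by exists (in1 *~ - z, tt).
by exists (in1 *~ - z, g).
Qed.

Lemma rotate_to_cone m A C D (X : chain m.+1 A C)
    (f : cmap X (zero_chain m.+1 A D)) (c : hom C D) :
  exists g : cmap (snoc (tail X) c) (cone f c),
    is_cmap (idm (obj X) *~ (-1) ^+ m.+1) g (idm D).
Proof.
(* This constant is (-1)^m, chosen to make the right end the identity; the left end then carries the
   whole sign of the rotation axiom. *)
have [g] := rotate_to_cone_from f.2 c (- (-1) ^+ m.+1).
rewrite exprS mulN1r opprK -expr2 sqrr_sign mulr1z => hg.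
have e : in1 *~ (-1) ^+ m ∘ first_arr (tail X) =
    colm (- first_arr (tail X)) f.1 ∘ (idm (obj X) *~ - (-1) ^+ m).
  rewrite compMzl compMzr compm1 (to_zob f.1) /colm compm0 addr0 compNr.
  by rewrite mulrNz mulNrz opprK.
case: m X f g hg e => [|m] X f g hg e.
  by exists (in1 *~ (-1) ^+ 0, tt).
by exists (in1 *~ (-1) ^+ m.+1, g).
Qed.

(** The components of [q] go into the second summands of the cocone. The differential there is [- d]
    for [Y], so the signs alternate, and m + 1 of them have accumulated at the right end. *)
Lemma map_to_cocone_from m A B C D V V' C' (X : chain m A C) (Y : chain m B C)
    (f : cmap X Y) (u : hom A B) (d : hom V B) (X' : chain m V' C')
    (h : hom C' D) (v : hom V' V) (q : cmap (snoc X' h) (Step B d Y))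
    (w : hom D C) :
  is_cmap v q w ->
  exists (g : cmap X' (cocone_from f u d)) (c : hom C' (source Y)),
    is_cmap (in2 ∘ v) g c /\ last_arr Y ∘ c = (w ∘ h) *~ (-1) ^+ m.+1.
Proof.
elim: m A B V V' X Y f u d X' v q =>
  [|m IH] A B V V' X Y f u d X' v q /= [h1 h2].
  exists tt, (- q.1); rewrite compNl h1 compA rowm_in2 compNl; split=> //.
  by rewrite compNr -h2 expr1 mulrNz mulr1z.
have [|g [c [hg ec]]] := IH _ _ _ _ (tail X) (tail Y) f.2 f.1 (arr Y)
  (tail X') q.1 q.2; first by case: Y f q h1 h2.
have [g' hg'] := is_cmap_scale (-1) hg.
exists (in2 ∘ q.1 *~ -1, g'), (c *~ -1); split; last first.
  by rewrite compMzr ec -mulrzA mulrC -exprS.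
split=> //=; rewrite compMzl -compA h1 [in RHS]compA blockm_in2 /colm compm0.
by rewrite add0r mulrNz mulr1z !compNr compNl -compA.
Qed.

End Signs.

Section Rotation.
Variables (T : additiveCat) (E : extBifunctor T) (k : nat).
Variables (s : assignment E k.+1) (S : functorData T T).
Variable dl : forall A : T, E (S A) A.
Hypotheses (hs : is_cov_realization s) (hS : is_shift dl).
Implicit Types A B C D V W : T.

Lemma real_rotate A C (h : hom C (S A)) (Z : chain k.+1 A C) :
  s (pull h (dl A)) Z ->
  s (push (arr Z) (dl A) *~ (-1) ^+ k.+1) (snoc (tail Z) h).
Proof.
move=> sZ; have hZ := real_cov hs sZ.
have hZ0 : push (arr Z) (pull h (dl A)) = 0 := cov_push hZ.
have [W sW] := real_ex hs (push (arr Z) (dl A) *~ (-1) ^+ k.+1).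
have [f [hf sK]] := real_cone hs hS sZ (real_zero_chain hs hS A).
have [g hg] := rotate_to_cone f h.
(* The cone realizes the extension without its sign. The lift takes the sign as left end, where it
   cancels that of [g]. *)
have [j hj] : exists j : cmap (cone f h) W,
    is_cmap (idm (obj Z) *~ (-1) ^+ k.+1) j (idm (S A)).
  by apply: (real_lift hs sK sW); rewrite pull_id pushMz push_id.
have := is_cmap_comp hg hj.
rewrite compMzl compMzr !comp1m sign_mulz => hgj.
apply: (real_of_map hs hS _ sW hgj); split.
- apply/is_complex_snoc; split; first exact: (cov_complex hZ).2.
  by apply: (shift_pull_inj hS); rewrite pull_comp; exact: cov_pull hZ.
- rewrite raddfMz /= -push_comp.
  have -> : first_arr (snoc (tail Z) h) ∘ arr Z = 0.
    by apply/first_snoc; exact: (cov_complex hZ).1.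
  by rewrite push0l mul0rz.
- have [y] := last_snoc (idm (source (snoc (tail Z) h))).
  rewrite compm1 => ->; rewrite raddfMz /= pull_comp -push_pull.
  by rewrite hZ0 raddf0 mul0rz.
- move=> V; apply/cov_exact_snoc; split; first exact: (cov_mid hZ V).2.
  move=> v; split=> [hv|[w <-]].
    have [|g' ->] := cov_right hZ (y := v); last by exists g'.
    by rewrite -pull_comp hv pull0l.
  rewrite compA; apply: (shift_pull_inj hS); rewrite !pull_comp.
  by rewrite (cov_pull hZ) raddf0.
- move=> V y; rewrite raddfMz /= => e.
  have : push (arr Z) (pull y (dl A)) = 0.
    rewrite push_pull -[LHS](sign_mulz _ k.+1) e mul0rz //.
  move=> /(real_push hs sZ)[g']; rewrite -pull_comp => /(shift_pull_eq hS) ->.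
  by have [y' <-] := snoc_last (tail Z) h g'; exists y'.
Qed.

Lemma real_unrotate A C (h : hom C (S A)) (Z : chain k.+1 A C) :
  s (push (arr Z) (dl A) *~ (-1) ^+ k.+1) (snoc (tail Z) h) ->
  s (pull h (dl A)) Z.
Proof.
set z := (-1) ^+ k.+1; move=> sR; have hR := real_cov hs sR.
have zK (V : zmodType) (x : V) : x *~ z *~ z = x := sign_mulz x k.+1.
have [cR hR0] := (is_complex_snoc _ _).1 (cov_complex hR).
have eR V := (cov_exact_snoc V _ _).1 (cov_mid hR V).
have cZ0 : first_arr (tail Z) ∘ arr Z = 0.
  apply/(first_snoc (tail Z) h); apply: (shift_push_inj hS).
  rewrite push_comp -[LHS]zK -raddfMz /= (cov_push hR) mul0rz //.
have hZ : is_covangle Z (pull h (dl A)).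
  split.
  - by split.
  - have [y ey] := snoc_last (tail Z) h (idm C); rewrite compm1 in ey.
    have e0 : pull (last_arr (snoc (tail Z) h)) (push (arr Z) (dl A)) = 0.
      by rewrite -[LHS]zK -raddfMz /= (cov_pull hR) mul0rz.
    change (push (arr Z) (pull h (dl A)) = 0).
    by rewrite push_pull -ey pull_comp e0 raddf0.
  - rewrite -pull_comp; change (pull (h ∘ last_arr (tail Z)) (dl A) = 0).
    by rewrite hR0 pull0l.
  - move=> V; split; last exact: (eR V).1.
    move=> v; split=> [hv|[w <-]]; last by rewrite compA cZ0 comp0m.
    (* Exactness at [obj Z] sits at the left end of the rotated sequence, so it is read off from
       extensions; fullness of [S] turns the resulting morphism [S V -> S A] into one [V -> A]. *)
    have [m em] := real_first_kernel dl hs sR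
      ((first_snoc (tail Z) h v).2 hv).
    have [m' em'] := shift_full hS (m *~ z); exists m'.
    apply: (shift_push_eq hS); rewrite em push_comp (shift_nat hS) -em'.
    by rewrite pullMz !raddfMz /= push_pull.
  - move=> V y; rewrite -pull_comp => /(shift_pull_inj hS).
    by move=> /((eR V).2 y).1[g <-]; exists g.
(* Realizations of [dl A] have zero first arrow, so this cocone begins with [[0; arr Z]] up to sign,
   and [Y] realizes the same extension as the given rotated sequence. *)
have [X [Y [f [sX sY hf sK]]]] := real_EA2op hs (dl A) (arr Z *~ z).
rewrite pushMz in sY; have hY := real_cov hs sY.
have X0 : arr X = 0.
  by apply: (shift_push_inj hS); exact: cov_push (real_cov hs sX).
have [q hq] : exists q : cmap (snoc (tail Z) h) Y, is_cmap (idm _) q (idm _).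
  by apply: (real_lift hs sR sY); rewrite push_id pull_id.
have [p ep] : exists p : hom (source Y) C, h ∘ p = last_arr Y.
  have [y ->] := cov_right hR (cov_pull hY).
  by have [y' ->] := last_snoc y; exists y'.
have [W sW] := real_ex hs (pull h (dl A)).
have [g [c [hg ec]]] : exists (g : cmap (tail Z)
    (cocone_from f.2 f.1 (arr Y))) (c : hom C (source Y)),
    is_cmap (in2 ∘ idm _) g c /\ last_arr (tail Y) ∘ c =
    (idm _ ∘ h) *~ (-1) ^+ k.+1.
  by apply: map_to_cocone_from; case: (Y) q hq => *; eassumption.
rewrite compm1 in hg; rewrite comp1m in ec.
have hg' : is_cmap (idm A *~ z) ((in2, g) : cmap Z (cocone (arr Z *~ z) f)) c.
  split=> //=; rewrite X0 /colm compm0 add0r compMzr compm1 compMzr zK //.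
have [j hj] : exists j : cmap (cocone (arr Z *~ z) f) W,
    is_cmap (idm A *~ z) j (p *~ z).
  apply: (real_lift hs sK sW).
  by rewrite pushMz push_id pullMz -pull_comp ep.
have := is_cmap_comp hg' hj.
rewrite compMzl comp1m zK => hgj.
(* The composite from [Z] to [W] has right end [p *~ z ∘ c]. Since [h] does not distinguish it from
   the identity, the difference factors through the last arrow of [W] and is removed by a homotopy
   at the right end. *)
have eh : h ∘ (p *~ z ∘ c) = h.
  by rewrite compMzl compMzr compA ep ec zK.
have [|psi epsi] := cov_right (real_cov hs sW) (y := p *~ z ∘ c - idm C).
  by rewrite -pull_comp compBr eh compm1 subrr pull0l.
have [w hw] := cmap_shift_right psi (cov_complex hZ) hgj.
by apply: (real_of_map hs hS hZ sW (f := w)); move: hw;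
  rewrite -epsi opprB addrC subrK.
Qed.

(** In the rotated sequences [b] and [S a] are the two ends, and the commuting square gives the
    compatibility of extensions needed for a lift. Cutting off the last arrow leaves the wanted
    map. *)
Lemma real_fill A B C D (d : E C A) (r : E D B) (X : chain k.+1 A C)
    (Y : chain k.+1 B D) (a : hom A B) (b : hom (obj X) (obj Y)) :
  s d X -> s r Y -> b ∘ arr X = arr Y ∘ a ->
  exists (f : cmap X Y) (c : hom C D),
    [/\ is_cmap a f c, f.1 = b & push a d = pull c r].
Proof.
have [h ->] := shift_pull_surj hS d; have [h' ->] := shift_pull_surj hS r.
move=> sX sY e.
have [q hq] : exists q : cmap (snoc (tail X) h) (snoc (tail Y) h'),
    is_cmap b q (fmap S a).
  apply: (real_lift hs (real_rotate sX) (real_rotate sY)).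
  by rewrite !raddfMz /= -push_comp e push_comp (shift_nat hS) push_pull.
have [g [c [hg ec]]] := is_cmap_snoc hq.
exists (b, g), c; split=> //.
by rewrite push_pull (shift_nat hS) -!pull_comp ec.
Qed.

End Rotation.

(** * Enlarging an end term, homotopies of cones, and cone filling *)

Section EndChange.
Variable T : additiveCat.
Implicit Types A B C D V W : T.

(** With [u] a projection and [v] an inclusion, [chain_pre] and [chain_post] add a summand to one
    end term without carrying zero summands through the middle terms. *)
Definition chain_pre m A A' B : chain m A B -> hom A' A -> chain m A' B :=
  match m with
  | 0%N => fun X u => X ∘ u
  | m'.+1 => fun X u => Step (obj X) (arr X ∘ u) (tail X)
  end.

Fixpoint chain_post m A B B' : chain m A B -> hom B B' -> chain m A B' :=
  match m with
  | 0%N => fun X v => v ∘ X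
  | m'.+1 => fun X v => Step (obj X) (arr X) (chain_post (tail X) v)
  end.

Lemma first_pre m A A' B (X : chain m A B) (u : hom A' A) V (x : hom V A') :
  first_arr (chain_pre X u) ∘ x = 0 <-> first_arr X ∘ (u ∘ x) = 0.
Proof. by case: m X => [|m] X /=; rewrite -compA. Qed.

Lemma last_pre m A A' B (X : chain m A B) (u : hom A' A) :
  exists y, last_arr (chain_pre X u) = last_arr X ∘ y.
Proof.
case: m X => [|m] X /=; first by exists u.
by exists (idm _); rewrite compm1.
Qed.

Lemma pre_last m A A' B (X : chain m A B) (u : hom A' A) (u' : hom A A') V
    (y : hom V (source X)) : u ∘ u' = idm A ->
  exists y', last_arr (chain_pre X u) ∘ y' = last_arr X ∘ y.
Proof.
move=> e; case: m X y => [|m] X y /=; last by exists y.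
by exists (u' ∘ y); rewrite -compA (compA u) e comp1m.
Qed.

Lemma is_complex_pre m A A' B (X : chain m A B) (u : hom A' A) :
  is_complex X -> is_complex (chain_pre X u).
Proof. by case: m X => [|m] X //= [e h]; rewrite compA e comp0m. Qed.

Lemma cov_exact_pre m A A' B (X : chain m A B) (u : hom A' A) (u' : hom A A')
    W : u ∘ u' = idm A -> cov_exact W X -> cov_exact W (chain_pre X u).
Proof.
move=> e; case: m X => [|m] X //= [h1 h2]; split=> // v.
split=> [/h1[w <-]|[w <-]].
  by exists (u' ∘ w); rewrite -compA (compA u) e comp1m.
by apply/h1; exists (u ∘ w); rewrite compA.
Qed.

Lemma is_cmap_pre m A A' B C D (X : chain m A B) (u : hom A' A)
    (Y : chain m C D) (a : hom A C) (a' : hom A' C) (f : cmap X Y)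
    (b : hom B D) :
  is_cmap a f b -> first_arr Y ∘ a' = first_arr Y ∘ (a ∘ u) ->
  exists f' : cmap (chain_pre X u) Y, is_cmap a' f' b.
Proof.
case: m X Y f => [|m] X Y f /= h e.
  by exists tt; rewrite compA h e !compA.
by exists f; rewrite compA h.1 e !compA; split=> //; exact: h.2.
Qed.

Lemma last_post m A B B' (X : chain m A B) (v : hom B B') V
    (y : hom V (source (chain_post X v))) :
  exists y', last_arr (chain_post X v) ∘ y = v ∘ (last_arr X ∘ y').
Proof.
by elim: m A X y => [|m IH] A X y /=; [exists y; rewrite compA | exact: IH].
Qed.

Lemma post_last m A B B' (X : chain m A B) (v : hom B B') V
    (y : hom V (source X)) :
  exists y', last_arr (chain_post X v) ∘ y' = v ∘ (last_arr X ∘ y).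
Proof.
by elim: m A X y => [|m IH] A X y /=; [exists y; rewrite compA | exact: IH].
Qed.

Lemma first_post m A B B' (X : chain m A B) (v : hom B B') (v' : hom B' B) V
    (x : hom V A) : v' ∘ v = idm B ->
  first_arr (chain_post X v) ∘ x = 0 <-> first_arr X ∘ x = 0.
Proof.
move=> e; case: m X => [|m] X //=; split=> h; last by rewrite -compA h compm0.
by rewrite -[X]comp1m -e -!compA (compA v) h compm0.
Qed.

Lemma is_complex_post m A B B' (X : chain m A B) (v : hom B B') :
  is_complex X -> is_complex (chain_post X v).
Proof.
elim: m A X => [|m IH] A X //= [e h]; split; last exact: IH.
by case: m X e {IH h} => [|m] X //= e; rewrite -compA e compm0.
Qed.

Lemma cov_exact_post m A B B' (X : chain m A B) (v : hom B B')
    (v' : hom B' B) W :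
  v' ∘ v = idm B -> cov_exact W X -> cov_exact W (chain_post X v).
Proof.
move=> e; elim: m A X => [|m IH] A X //= [h1 h2]; split; last exact: IH.
by move=> x; split=> [/(first_post _ _ e)/h1|/h1/(first_post _ _ e)].
Qed.

Lemma is_cmap_post m A B B' C D (X : chain m A B) (v : hom B B')
    (Y : chain m C D) (a : hom A C) (f : cmap X Y) (b : hom B' D) :
  is_cmap a f (b ∘ v) ->
  exists f' : cmap (chain_post X v) Y, is_cmap a f' b.
Proof.
elim: m A C X Y a f => [|m IH] A C X Y a f /=.
  by exists tt; rewrite compA.
by move=> [h1 /IH[f' h]]; exists (f.1, f').
Qed.

(** The cones are equal as chains, not merely isomorphic, since all middle terms coincide and only
    the last arrow is rewritten. This allows the filled cone to be identified with [sseq_cone]. *)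
Lemma cmap_unpost m A B C D D' F (X : chain m A C) (Y : chain m B D)
    (v : hom D D') (v' : hom D' D) (f : cmap X (chain_post Y v))
    (a : hom A B) (c : hom C D')
    (l : forall V, hom V D' -> hom (C ⊕ V) F) :
  v' ∘ v = idm D -> is_cmap a f c ->
  exists f' : cmap X Y, is_cmap a f' (v' ∘ c) /\
    cone_from f l = cone_from f' (fun V y => l V (v ∘ y)).
Proof.
move=> e; elim: m A B X Y a f => [|m IH] A B X Y a f /=.
  by move=> h; exists tt; rewrite -compA h !compA e comp1m.
by move=> [h1 /IH[f' [h2 e2]]]; exists (f.1, f'); rewrite e2.
Qed.

(** The equation includes the preceding differential because [cone_from f l] starts at
    [target (chain_pre X u)], which becomes convertible to [target X] only once the shape of [m] is
    known. *)
Lemma cmap_unpre m A A' B C D F (X : chain m A C) (Y : chain m B D)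
    (u : hom A' A) (u' : hom A A') (f : cmap (chain_pre X u) Y)
    (a : hom A' B) (c : hom C D)
    (l : forall V, hom V D -> hom (C ⊕ V) F) :
  u ∘ u' = idm A -> is_cmap a f c ->
  exists f' : cmap X Y, is_cmap (a ∘ u') f' c /\
    forall b : hom A' B,
    Step (target (chain_pre X u) ⊕ B)
      (colm (- first_arr (chain_pre X u)) b) (cone_from f l) =
    Step (target X ⊕ B) (colm (- (first_arr X ∘ u)) b) (cone_from f' l)
      :> chain m.+1 A' F.
Proof.
move=> e; case: m X Y f => [|m] X Y f /= h; exists f => //.
  by rewrite compA -h -!compA e compm1.
by case: h => h1 h2; rewrite compA -h1 -!compA e compm1.
Qed.

(* (f, c) is g modified by the homotopy t : X_2 -> Y_1, and i is given by the
   elementary matrix of t on X_2 + Y_1. *)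
Lemma cone_homotopy m A C D (X : chain m.+1 A C) (Y : chain m.+1 A D)
    (g : cmap X Y) (c0 : hom C D) (t : hom (target (tail X)) (obj Y)) :
  is_complex X -> is_complex Y -> is_cmap (idm A) g c0 ->
  exists (f : cmap X Y) (c : hom C D) (w : hom C (source Y)),
    [/\ is_cmap (idm A) f c, f.1 = g.1 + t ∘ first_arr (tail X),
        c = c0 + last_arr Y ∘ w
      & exists i : cmap (cone f c) (cone g c0),
          is_cmap (idm (obj X)) i (idm D)].
Proof.
case: m X Y g t => [|m] X Y g t /= [dX cX] [dY cY] [h1 h2].
  exists (g.1 + t ∘ tail X, tt), (c0 + tail Y ∘ t), t; split=> //=.
    split; first by rewrite compDl -compA dX compm0 addr0.
    by rewrite compDl compDr h2 compA.
  exists (blockm (idm _) 0 t (idm _), tt); split=> /=.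
    rewrite blockm_colm compm1 !comp1m comp0m addr0 compNr.
    by rewrite addrCA addNr addr0.
  by rewrite rowm_blockm !compm1 compm0 add0r comp1m.
exists (g.1 + t ∘ arr (tail X), (g.2.1 + arr (tail Y) ∘ t, g.2.2)), c0, 0.
move: dX cX dY cY h2 => dX [dX2 cX] dY [dY2 cY] [h2 h3].
split=> //=; last 2 first.
- by rewrite compm0 addr0.
- exists (blockm (idm _) 0 t (idm _), (idm _, cmap_id _)); split=> /=.
    rewrite blockm_colm compm1 !comp1m comp0m addr0 compNr.
    by rewrite addrCA addNr addr0.
  split; last exact: is_cmap_id.
  rewrite comp1m blockm_blockm !compm1 !compm0 !comp0m !addr0 !add0r.
  done.
split; first by rewrite compDl -compA dX compm0 addr0.
split; first by rewrite compDl compDr h2 !compA.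
by apply: is_cmap_start h3; rewrite compDr compA dY2 comp0m addr0.
Qed.

End EndChange.

Section ConeFilling.
Variables (T : additiveCat) (E : extBifunctor T) (k : nat).
Variables (s : assignment E k.+1) (S : functorData T T).
Variable dl : forall A : T, E (S A) A.
Hypotheses (hs : is_cov_realization s) (hS : is_shift dl).
Implicit Types A B C D V W : T.

(** From [real_fill] only the right end [c0] is kept: it writes [d] as [pull c0 r], to which the
    cone construction applies. Its map [g] and the prescribed [b] agree on the image of [arr X],
    hence differ by [t ∘ d_1], and [t] is the homotopy used. *)
Lemma real_fill_cone A C D (d : E C A) (r : E D A) (X : chain k.+1 A C)
    (Y : chain k.+1 A D) (b : hom (obj X) (obj Y)) :
  s d X -> s r Y -> b ∘ arr X = arr Y ->
  exists (f : cmap X Y) (c : hom C D),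
    [/\ is_cmap (idm A) f c, f.1 = b, pull c r = d
      & s (push (arr X) r) (cone f c)].
Proof.
move=> sX sY e.
have [|_ [c0 [_ _ ed]]] := real_fill hs hS (a := idm A) sX sY (b := b).
  by rewrite compm1.
rewrite push_id in ed; rewrite {}ed in sX *.
have [g [hg sK]] := real_cone hs hS sX sY.
have [|t et] := real_contra hs sX (g := b - g.1).
  by rewrite compBl e hg.1 compm1 subrr.
have hY := real_cov hs sY.
have [f [c [w [hf f1 ec [i hi]]]]] :=
  cone_homotopy t (cov_complex (real_cov hs sX)) (cov_complex hY) hg.
have er : pull c r = pull c0 r.
  by rewrite ec pullD pull_comp (cov_pull hY) raddf0 addr0.
exists f, c; split=> //; first by rewrite f1 -et addrC subrK.
rewrite -er in sX; exact: (real_of_map hs hS (covangle_cone hs sX sY hf) sK hi).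
Qed.

(* X + (B = B -> 0), in coordinates of A + B in which the extension is [d, a d]. *)
Lemma real_hat_left A B C (d : E C A) (X : chain k.+1 A C) (a : hom A B) :
  s d X ->
  s (push (colm (idm A) a) d)
    (Step (obj X ⊕ B) (blockm (arr X) 0 (- a) (idm B))
       (chain_pre (tail X) pr1)).
Proof.
pose Z : chain k.+1 (A ⊕ B) C := Step (obj X ⊕ B)
  (blockm (arr X) 0 (- a) (idm B)) (chain_pre (tail X) pr1).
move=> sX; rewrite -/Z; have hX := real_cov hs sX.
have [dX cX] := cov_complex hX.
have [W sW] := real_ex hs (push (colm (idm A) a) d).
have cW := cov_complex (real_cov hs sW).
have [g [hg1 hg2]] : exists g : cmap X W, is_cmap (colm (idm A) a) g (idm C).
  by apply: (real_lift hs sX sW); rewrite pull_id.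
have [g' hg'] : exists g' : cmap (tail Z) (tail W),
    is_cmap (rowm g.1 (arr W ∘ in2)) g' (idm C).
  apply: is_cmap_pre hg2 _; rewrite comp_rowm (compA _ (arr W)) cW.1 comp0m.
  by rewrite /rowm comp0m addr0 compA.
have hf : is_cmap (idm (A ⊕ B))
    ((rowm g.1 (arr W ∘ in2), g') : cmap Z W) (idm C).
  split=> //=; rewrite compm1; apply: rowm_ext; rewrite -compA.
    rewrite blockm_in1 rowm_colm hg1 /colm compDr compm1.
    by rewrite !compNr -!compA addrK.
  by rewrite blockm_in2 rowm_colm compm0 add0r compm1.
have e1 : (pr1 : hom (obj X ⊕ B) _) ∘ in1 = idm (obj X) by exact: pr1_in1.
apply: (real_of_map hs hS _ sW hf); split.
- split; last exact: is_complex_pre.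
  apply/first_pre; rewrite pr1_blockm comp_rowm dX compm0 /rowm !comp0m.
  by rewrite addr0.
- change (push (blockm (arr X) 0 (- a) (idm B)) (push (colm (idm A) a) d) = 0).
  rewrite -push_comp blockm_colm compm1 comp1m compNl compm1 comp0m addr0 addNr.
  by rewrite /colm compm0 addr0 push_comp (cov_push hX) raddf0.
- have [y ey] := last_pre (tail X) (pr1 : hom (_ ⊕ B) _).
  change (pull (last_arr (tail Z)) (push (colm (idm A) a) d) = 0).
  by rewrite ey -push_pull pull_comp (cov_pull hX) !raddf0.
- move=> V; split; last exact: cov_exact_pre e1 (cov_mid hX V).2.
  move=> v; split=> [/first_pre /((cov_mid hX V).1 _).1[w ew]|[w <-]].
    exists (colm w (a ∘ w + pr2 ∘ v)).
    rewrite blockm_colm comp0m addr0 comp1m compNl addKr ew.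
    exact: esym (colm_eta _).
  apply/first_pre; rewrite (compA pr1) pr1_blockm compA comp_rowm dX compm0.
  by rewrite /rowm !comp0m addr0 comp0m.
- move=> V y e; have [|g0 ->] := cov_right hX (y := y).
    have := congr1 (push pr1) e.
    by rewrite -push_pull -push_comp pr1_colm push_id raddf0.
  have [y' ey'] := pre_last (X := tail X) g0 e1; exists y'.
  exact: esym ey'.
Qed.

(* Y + (A -> 0 -> ... -> 0 -> S A). *)
Lemma real_hat_right A B D (r : E D B) (Y : chain k.+1 B D) :
  s r Y ->
  s (pull pr1 (push in1 (- dl A)) + pull pr2 (push in2 r))
    (chain_pre (chain_post Y (in2 : hom D (S A ⊕ D))) (pr2 : hom (A ⊕ B) B)).
Proof.
set eps := _ + _.
pose Z : chain k.+1 (A ⊕ B) (S A ⊕ D) :=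
  chain_pre (chain_post Y (in2 : hom D (S A ⊕ D))) (pr2 : hom (A ⊕ B) B).
rewrite -/Z.
move=> sY; have hY := real_cov hs sY.
have [dY cY] := cov_complex hY.
have e1 : pull in1 eps = push in1 (- dl A).
  rewrite /eps raddfD /= -!pull_comp pr1_in1 pr2_in1 pull_id pull0l.
  exact: addr0.
have e2 : pull in2 eps = push in2 r.
  rewrite /eps raddfD /= -!pull_comp pr1_in2 pr2_in2 pull_id pull0l.
  exact: add0r.
have [W sW] := real_ex hs eps; have hW := real_cov hs sW.
have W0 : arr W ∘ in1 = 0.
  apply: (shift_push_inj hS); apply: oppr_inj; rewrite oppr0 -raddfN /=.
  by rewrite push_comp -e1 push_pull (cov_push hW) raddf0.
have [g hg] : exists g : cmap Y W, is_cmap in2 g in2.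
  by apply: (real_lift hs sY sW); rewrite e2.
have [g' hg'] : exists g' : cmap (chain_post Y in2) W,
    is_cmap in2 g' (idm (S A ⊕ D)).
  by apply: is_cmap_post; rewrite comp1m; exact: hg.
have [f hf] : exists f : cmap Z W, is_cmap (idm (A ⊕ B)) f (idm (S A ⊕ D)).
  apply: is_cmap_pre hg' _; rewrite compm1; apply: rowm_ext.
    by rewrite -!compA pr2_in1 !compm0 W0.
  by rewrite -!compA pr2_in2 compm1.
have p2 (F G : T) : pr2 ∘ in2 = idm G :> hom G G := pr2_in2 F G.
apply: (real_of_map hs hS _ sW hf); split.
- by apply: is_complex_pre; apply: is_complex_post; exact: cov_complex hY.
- change (push (arr Y ∘ pr2) eps = 0).
  rewrite /eps raddfD /= !push_pull -!push_comp -!compA pr2_in1 pr2_in2.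
  rewrite !compm0 compm1 push0l raddf0 add0r.
  have hY0 : push (arr Y) r = 0 := cov_push hY.
  by rewrite hY0 raddf0.
- have [y ->] := last_pre (chain_post Y (in2 : hom D (S A ⊕ D)))
    (pr2 : hom (A ⊕ B) B).
  have [y' ->] := last_post y.
  by rewrite !pull_comp e2 -push_pull (cov_pull hY) !raddf0.
- move=> V; apply: cov_exact_pre (p2 _ _) _.
  by apply: cov_exact_post (p2 _ _) _; exact: cov_mid hY V.
- move=> V y; rewrite /eps raddfD /= -!push_pull -!pull_comp => ey.
  have y1 : pr1 ∘ y = 0.
    apply: (shift_pull_inj hS); have := congr1 (push pr1) ey.
    rewrite raddfD /= raddf0 -!push_comp pr1_in1 pr1_in2 push0l addr0 push_id.
    by rewrite raddfN => /eqP; rewrite oppr_eq0 => /eqP.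
  have [|g0 eg] := cov_right hY (y := pr2 ∘ y).
    have := congr1 (push pr2) ey.
    rewrite raddfD /= raddf0 -!push_comp pr2_in1 pr2_in2.
    by rewrite push0l add0r push_id.
  have [y2 e2'] := post_last (in2 : hom D (S A ⊕ D)) g0.
  have [y3 e3] := pre_last y2 (p2 A B); exists y3.
  rewrite e3 e2' -eg [LHS]colm_eta y1 /colm compm0 add0r //.
Qed.

Lemma angle_cone (X Y : Sseq k.+1 S) (a : hom (sfst X) (sfst Y))
    (b : hom (target (schain X)) (target (schain Y))) :
  s (pull (smap X) (dl (sfst X))) (schain X) ->
  s (pull (smap Y) (dl (sfst Y))) (schain Y) ->
  b ∘ first_arr (schain X) = first_arr (schain Y) ∘ a ->
  exists (f : cmap (schain X) (schain Y)) (c : hom (slst X) (slst Y)),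
    [/\ is_smor a f c, cmap_first f c = b
      & s (pull (smap (sseq_cone a f c)) (dl (sfst (sseq_cone a f c))))
          (schain (sseq_cone a f c))].
Proof.
case: X Y a b => [A C X h] [B D Y h'] /= a b sX sY eb.
have sX' := real_hat_left a sX; have sY' := real_hat_right A sY.
set r := _ + _ in sY'.
pose X' : chain k.+1 (A ⊕ B) C := Step (obj X ⊕ B)
  (blockm (arr X) 0 (- a) (idm B)) (chain_pre (tail X) pr1).
pose Y' : chain k.+1 (A ⊕ B) (S A ⊕ D) := chain_pre (chain_post Y in2) pr2.
(* The new first component vanishes on the twisted column [[arr X; - a]] exactly because the given
   square commutes. *)
have [|f [c [hf ef ec sK]]] := real_fill_cone (X := X') (Y := Y')
    (b := rowm b (arr Y)) sX' sY'.
  rewrite /= rowm_blockm eb compm0 compm1 add0r compNr subrr.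
  by rewrite /rowm comp0m add0r.
(* The sign put on [dl A] in the extension of [Y'] produces the [- h] of the mapping cone. *)
have c1 : pr1 ∘ c = - h.
  apply: (shift_pull_eq hS); have := congr1 (push pr1) ec.
  rewrite raddfD /= raddfD /= !push_pull -!push_comp.
  rewrite pr1_in1 pr1_in2 pr1_colm !push_id push0l !raddf0 addr0.
  by rewrite pullNl -pull_comp raddfN /= => /eqP; rewrite eqr_oppLR => /eqP.
have c2 : pull (pr2 ∘ c) (pull h' (dl B)) = push a (pull h (dl A)).
  have := congr1 (push pr2) ec.
  rewrite raddfD /= raddfD /= !push_pull -!push_comp.
  rewrite pr2_in1 pr2_in2 pr2_colm push_id push0l !raddf0 add0r.
  by rewrite pull_comp.
have hf2 : is_cmap (rowm b (arr Y)) (f.2 : cmap (chain_pre (tail X) pr1)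
    (chain_post (tail Y) in2)) c by rewrite -ef; exact: hf.2.
have [f' [hf' ef']] := cmap_unpost (fun V y => rowm c y)
  (pr2_in2 (S A) D) hf2.
have [f'' [hf'' ef'']] := cmap_unpre (X := tail X)
  (fun V y => rowm c (in2 ∘ y)) (pr1_in1 (obj X) B) hf'.
rewrite rowm_in1 in hf''.
exists (b, f''), (pr2 ∘ c); split=> //.
  split; first by split.
  apply: (shift_pull_eq hS); rewrite /= pull_comp c2.
  by rewrite push_pull (shift_nat hS) -pull_comp.
have eK : schain (sseq_cone (X := SSeq X h) (Y := SSeq Y h') a
    ((b, f'') : cmap X Y) (pr2 ∘ c)) = cone f c.
  rewrite /sseq_cone /= ef ef' ef''.
  rewrite (@cone_from_eq _ _ _ _ _ _ _ _ _ f''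
    (fun V y => blockm (- h) 0 (pr2 ∘ c) y) (fun V y => rowm c (in2 ∘ y))).
    by rewrite /blockm /rowm comp0m addr0 compNl.
  move=> V y; apply: colm_ext; rewrite ?pr1_blockm ?pr2_blockm comp_rowm compA.
    by rewrite pr1_in2 comp0m c1.
  by rewrite pr2_in2 comp1m.
have sE (x : E (S A ⊕ D) (obj X ⊕ B)) (Z : chain k.+1 (obj X ⊕ B) (S A ⊕ D)) :
    x = push (arr X') r -> Z = cone f c -> s x Z by move=> -> ->; exact: sK.
apply: sE eK.
(* Pushing [- dl A] along the column [[arr X; - a]] yields the entries [- S (arr X)] and [S a] of
   the last arrow of the cone. *)
rewrite /sseq_cone /= /rowm pullD !pull_comp pullD !pull_comp -!(shift_nat hS).
rewrite pullNl -!push_pull -!(shift_nat hS).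
rewrite [in RHS]raddfD /= !push_pull -!push_comp blockm_in1 blockm_in2.
rewrite /colm compm0 add0r compm1 compNr raddfN pushD pushNl opprD opprK.
by rewrite !push_comp -push_pull (shift_nat hS).
Qed.

End ConeFilling.

(** * Direct sums, retracts and the axioms *)

Section Sums.
Variable T : additiveCat.
Implicit Types A B C D V W : T.

Lemma is_complex_retract m A B C D (X : chain m A C) (Y : chain m B D)
    (a : hom A B) (f : cmap X Y) (c : hom C D) (a' : hom B A)
    (f' : cmap Y X) (c' : hom D C) :
  is_cmap a f c -> is_cmap a' f' c' -> a ∘ a' = idm B ->
  cmap_comp f f' = cmap_id Y -> is_complex X -> is_complex Y.
Proof.
elim: m A B X Y a f a' f' => [|m IH] A B X Y a f a' f' //=.
move=> [h1 h2] [h1' h2'] e [e1 e2] [dX cX].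
split; last exact: IH h2 h2' e1 e2 cX.
rewrite -[arr Y]compm1 -e (compA (arr Y)) -h1 -!compA (compA _ f.1).
by rewrite -(cmap_firstP h2) -!compA (compA _ (arr X)) dX comp0m compm0.
Qed.

Lemma chain_sum_left m A B C D (X : chain m A C) (Y : chain m B D) :
  exists (f : cmap X (chain_sum X Y)) (g : cmap (chain_sum X Y) X),
    [/\ is_cmap in1 f in1, is_cmap pr1 g pr1 & cmap_comp g f = cmap_id X].
Proof.
elim: m A B X Y => [|m IH] A B X Y /=.
  exists tt, tt; rewrite blockm_in1 pr1_blockm /colm /rowm.
  by rewrite compm0 comp0m !addr0.
have [f [g [hf hg e]]] := IH _ _ (tail X) (tail Y).
exists (in1, f), (pr1, g); split=> /=; last by rewrite pr1_in1 e.
  by split=> //; rewrite blockm_in1 /colm compm0 addr0.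
by split=> //; rewrite pr1_blockm /rowm comp0m addr0.
Qed.

Lemma chain_sum_right m A B C D (X : chain m A C) (Y : chain m B D) :
  exists (f : cmap Y (chain_sum X Y)) (g : cmap (chain_sum X Y) Y),
    [/\ is_cmap in2 f in2, is_cmap pr2 g pr2 & cmap_comp g f = cmap_id Y].
Proof.
elim: m A B X Y => [|m IH] A B X Y /=.
  exists tt, tt; rewrite blockm_in2 pr2_blockm /colm /rowm.
  by rewrite compm0 comp0m !add0r.
have [f [g [hf hg e]]] := IH _ _ (tail X) (tail Y).
exists (in2, f), (pr2, g); split=> /=; last by rewrite pr2_in2 e.
  by split=> //; rewrite blockm_in2 /colm compm0 add0r.
by split=> //; rewrite pr2_blockm /rowm comp0m add0r.
Qed.

Lemma is_cmap_sum m A B C D A' C' (X : chain m A C) (Y : chain m B D)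
    (Z : chain m A' C') (a : hom A A') (f : cmap X Z) (c : hom C C')
    (b : hom B A') (g : cmap Y Z) (d : hom D C') :
  is_cmap a f c -> is_cmap b g d ->
  exists h : cmap (chain_sum X Y) Z, is_cmap (rowm a b) h (rowm c d).
Proof.
elim: m A B A' X Y Z a f b g => [|m IH] A B A' X Y Z a f b g /=.
  move=> h1 h2; exists tt; rewrite rowm_blockm comp_rowm !compm0 addr0 add0r.
  by rewrite h1 h2.
move=> [h1 h2] [h1' h2']; have [h hh] := IH _ _ _ _ _ _ _ _ _ _ h2 h2'.
exists (rowm f.1 g.1, h); split=> //=.
by rewrite rowm_blockm comp_rowm !compm0 addr0 add0r h1 h1'.
Qed.

Lemma first_sum m A B C D (X : chain m A C) (Y : chain m B D) V
    (x : hom V (A ⊕ B)) :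
  first_arr (chain_sum X Y) ∘ x = 0 <->
  first_arr X ∘ (pr1 ∘ x) = 0 /\ first_arr Y ∘ (pr2 ∘ x) = 0.
Proof.
have H A' B' (u : hom A A') (v : hom B B') : blockm u 0 0 v ∘ x = 0 <->
    u ∘ (pr1 ∘ x) = 0 /\ v ∘ (pr2 ∘ x) = 0.
  rewrite {1}[x]colm_eta blockm_colm !comp0m addr0 add0r.
  split=> [e|[-> ->]]; last by rewrite /colm !compm0 addr0.
  have := congr1 (fun z => pr1 ∘ z) e; have := congr1 (fun z => pr2 ∘ z) e.
  by rewrite /= pr1_colm pr2_colm !compm0.
by case: m X Y => [|m] X Y; exact: H.
Qed.

Lemma is_complex_sum m A B C D (X : chain m A C) (Y : chain m B D) :
  is_complex X -> is_complex Y -> is_complex (chain_sum X Y).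
Proof.
elim: m A B X Y => [|m IH] A B X Y //= [dX cX] [dY cY]; split; last exact: IH.
apply/first_sum; rewrite pr1_blockm pr2_blockm !comp_rowm dX dY !compm0.
by rewrite /rowm !comp0m !addr0; split.
Qed.

Lemma cov_exact_sum W m A B C D (X : chain m A C) (Y : chain m B D) :
  cov_exact W X -> cov_exact W Y -> cov_exact W (chain_sum X Y).
Proof.
elim: m A B X Y => [|m IH] A B X Y //= [hX hX'] [hY hY'].
split; last exact: IH; move=> v.
split=> [/first_sum[/hX[x ex] /hY[y ey]]|[w <-]].
  exists (colm x y); rewrite blockm_colm !comp0m addr0 add0r ex ey.
  exact: esym (colm_eta _).
apply/first_sum; rewrite !(compA _ (blockm _ _ _ _)) pr1_blockm pr2_blockm.
rewrite /rowm !comp0m addr0 add0r -!compA.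
by split; [apply/hX; exists (pr1 ∘ w) | apply/hY; exists (pr2 ∘ w)].
Qed.

End Sums.

Section Angulation.
Variables (T : additiveCat) (E : extBifunctor T) (k : nat).
Variables (s : assignment E k.+1) (S : functorData T T).
Variable dl : forall A : T, E (S A) A.
Hypotheses (hs : is_cov_realization s) (hS : is_shift dl).
Implicit Types A B C D V W : T.

Lemma covangle_retract A B C D (d : E C A) (r : E D B) (X : chain k.+1 A C)
    (Y : chain k.+1 B D) (a : hom A B) (f : cmap X Y) (c : hom C D)
    (a' : hom B A) (f' : cmap Y X) (c' : hom D C) :
  is_covangle X d -> is_cmap a f c -> is_cmap a' f' c' ->
  a ∘ a' = idm B -> cmap_comp f f' = cmap_id Y -> c ∘ c' = idm D ->
  push a' r = pull c' d -> is_covangle Y r.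
Proof.
move=> hX hf hf' ea ef ec e'.
have er : r = push a (pull c' d) by rewrite -e' -push_comp ea push_id.
have [y ey] := is_cmap_last hf; have [y' ey'] := is_cmap_last hf'.
have cY := is_complex_retract hf hf' ea ef (cov_complex hX).
split=> //.
- rewrite er -push_comp -(cmap_firstP hf) push_comp push_pull.
  by rewrite push_pull (cov_push hX) !raddf0.
- by rewrite er -push_pull -pull_comp -ey' pull_comp (cov_pull hX) !raddf0.
- move=> W; apply: (cov_exact_homotopic (e := 0) cY hf hf' _ (cov_mid hX W)).
  rewrite ea ef ec; exact: (homotopic_refl (idm B) (cmap_id Y) (idm D)).
- move=> W x ex; have [|g eg] := cov_right hX (y := c' ∘ x).
    by rewrite pull_comp -e' -push_pull ex raddf0.
  exists (y ∘ g); rewrite compA ey -compA -eg compA ec comp1m //.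
Qed.

(** Covers closure under isomorphisms and under summands at once. Going from [Y] to [X] and then
    along a lift of [(a, c)] into a realization of [r] gives identity ends. *)
Lemma real_retract A B C D (d : E C A) (r : E D B) (X : chain k.+1 A C)
    (Y : chain k.+1 B D) (a : hom A B) (f : cmap X Y) (c : hom C D)
    (a' : hom B A) (f' : cmap Y X) (c' : hom D C) :
  s d X -> is_cmap a f c -> is_cmap a' f' c' ->
  a ∘ a' = idm B -> cmap_comp f f' = cmap_id Y -> c ∘ c' = idm D ->
  push a d = pull c r -> push a' r = pull c' d -> s r Y.
Proof.
move=> sX hf hf' ea ef ec e e'.
have hY := covangle_retract (real_cov hs sX) hf hf' ea ef ec e'.
have [W sW] := real_ex hs r; have [g hg] := real_lift hs sX sW e.
have := is_cmap_comp hf' hg; rewrite ea ec => hgf.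
exact: (real_of_map hs hS hY sW hgf).
Qed.

Lemma pull_sum A B C D (h : hom C (S A)) (h' : hom D (S B)) :
  pull (rowm (fmap S in1 ∘ h) (fmap S in2 ∘ h')) (dl (A ⊕ B)) =
  pull pr1 (push in1 (pull h (dl A))) + pull pr2 (push in2 (pull h' (dl B))).
Proof.
by rewrite /rowm pullD !pull_comp -!(shift_nat hS) -!push_pull.
Qed.

(** The inclusions of both summands lift to a realization of the total extension; the combined map
    has identity ends because [[in1, in2]] is the identity. *)
Lemma real_sum A B C D (d : E C A) (r : E D B) (X : chain k.+1 A C)
    (Y : chain k.+1 B D) :
  s d X -> s r Y ->
  s (pull pr1 (push in1 d) + pull pr2 (push in2 r)) (chain_sum X Y).
Proof.
set eps := _ + _; move=> sX sY.
have hX := real_cov hs sX; have hY := real_cov hs sY.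
have e1 : push in1 d = pull in1 eps.
  rewrite /eps raddfD /= -!pull_comp pr1_in1 pr2_in1 pull_id pull0l addr0 //.
have e2 : push in2 r = pull in2 eps.
  rewrite /eps raddfD /= -!pull_comp pr1_in2 pr2_in2 pull_id pull0l add0r //.
have [W sW] := real_ex hs eps.
have [f hf] := real_lift hs sX sW e1; have [g hg] := real_lift hs sY sW e2.
have rowm1 A' B' : rowm in1 in2 = idm (A' ⊕ B') :> hom (_ : T) _.
  exact: bipE.
have [h] := is_cmap_sum hf hg; rewrite !rowm1 => hh.
have [i1 [p1 [hi1 hp1 _]]] := chain_sum_left X Y.
have [i2 [p2 [hi2 hp2 _]]] := chain_sum_right X Y.
have [[x1 ex1] [x2 ex2]] := (is_cmap_last hi1, is_cmap_last hi2).
have [[y1 ey1] [y2 ey2]] := (is_cmap_last hp1, is_cmap_last hp2).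
apply: (real_of_map hs hS _ sW hh); split.
- by apply: is_complex_sum; [exact: cov_complex hX | exact: cov_complex hY].
- change (push (blockm (arr X) 0 0 (arr Y)) eps = 0).
  have hX0 : push (arr X) d = 0 := cov_push hX.
  have hY0 : push (arr Y) r = 0 := cov_push hY.
  rewrite /eps raddfD /= !push_pull -!push_comp blockm_in1 blockm_in2.
  rewrite /colm !compm0 addr0 add0r !push_comp hX0 hY0 !raddf0 addr0 //.
- rewrite /eps raddfD /= -!push_pull -!pull_comp -ey1 -ey2 !pull_comp.
  by rewrite (cov_pull hX) (cov_pull hY) !raddf0 addr0.
- by move=> V; exact: cov_exact_sum (cov_mid hX V) (cov_mid hY V).
- move=> V y; rewrite /eps raddfD /= -!push_pull -!pull_comp => ey.
  have [|g1 eg1] := cov_right hX (y := pr1 ∘ y).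
    have := congr1 (push pr1) ey; rewrite raddfD /= raddf0 -!push_comp.
    by rewrite pr1_in1 pr1_in2 push_id push0l addr0.
  have [|g2 eg2] := cov_right hY (y := pr2 ∘ y).
    have := congr1 (push pr2) ey; rewrite raddfD /= raddf0 -!push_comp.
    by rewrite pr2_in1 pr2_in2 push_id push0l add0r.
  exists (x1 ∘ g1 + x2 ∘ g2); rewrite compDr !compA ex1 ex2 -!compA -eg1 -eg2.
  exact: colm_eta.
Qed.

Theorem shift_angulated :
  is_angulated k.+1 T S
    [set X | s (pull (smap X) (dl (sfst X))) (schain X)].
Proof.
split.
- exact: shift_autoequivalence hS.
- move=> [A C X h] [B D Y h'] [a [f [c [a' [f' [c' [[hf e] [hf' e']]]]]]]].
  move=> [_ _ _] [ea ef ec].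
  rewrite /= in a f c a' f' c' hf e hf' e' ea ef ec *.
  move=> sX; apply: real_retract sX hf hf' ea ef ec _ _.
    by rewrite push_pull (shift_nat hS) -!pull_comp e.
  by rewrite push_pull (shift_nat hS) -!pull_comp e'.
- move=> [A C X h] [B D Y h'] sX sY.
  by have := real_sum sX sY; rewrite -pull_sum.
- move=> [A C X h] [B D Y h'] /= sZ.
  have {}sZ : s (pull pr1 (push in1 (pull h (dl A))) +
    pull pr2 (push in2 (pull h' (dl B)))) (chain_sum X Y) by rewrite -pull_sum.
  have [i1 [p1 [hi1 hp1 e1]]] := chain_sum_left X Y.
  have [i2 [p2 [hi2 hp2 e2]]] := chain_sum_right X Y.
  split.
    apply: (real_retract sZ hp1 hi1 (pr1_in1 _ _) e1 (pr1_in1 _ _)).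
      rewrite raddfD /= !push_pull -!push_comp pr1_in1 pr1_in2 push_id push0l.
      by rewrite !raddf0 addr0.
    by rewrite raddfD /= -!pull_comp pr1_in1 pr2_in1 pull_id pull0l addr0.
  apply: (real_retract sZ hp2 hi2 (pr2_in2 _ _) e2 (pr2_in2 _ _)).
    rewrite raddfD /= !push_pull -!push_comp pr2_in1 pr2_in2 push_id push0l.
    by rewrite !raddf0 add0r.
  by rewrite raddfD /= -!pull_comp pr1_in2 pr2_in2 pull_id pull0l add0r.
- move=> A; change (s (pull (0 : hom zob (S A)) (dl A)) (id_left k.+1 A)).
  by rewrite pull0l; exact: real_id_left.
(* A sequence starting with [f] is found by realizing what its rotation must realize, splitting off
   the last arrow [h], and rotating back. *)
- move=> A B f.
  have [W] := real_ex hs (push f (dl A) *~ (-1) ^+ k.+1).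
  have [C [X [h ->]]] := snocP W => sX.
  exists C, (Step B f X), h.
  split; last exact: (@IsFirst T k.+1 A C (Step B f X)).
  exact: (real_unrotate hs hS (Z := Step B f X) sX).
- move=> [A C X h].
  have e : pull (fmap S (arr X) *~ (-1) ^+ k.+1) (dl (obj X)) =
      push (arr X) (dl A) *~ (-1) ^+ k.+1.
    by rewrite pullMz (shift_nat hS).
  split=> [sX|]; first by have := real_rotate hs hS sX; rewrite -e.
  move=> sR; apply: (real_unrotate hs hS (Z := X)); rewrite -e; exact: sR.
- move=> [A C X h] [B D Y h'] a b sX sY eb.
  have [f [c [hf ef ec]]] := real_fill hs hS sX sY eb.
  exists f, c; split=> //; split=> //; apply: (shift_pull_eq hS).
  by rewrite /= !pull_comp -ec push_pull (shift_nat hS).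
- by move=> X Y a b sX sY eb; exact: (angle_cone hs hS sX sY eb).
Qed.

End Angulation.

(** * The stable category *)

Section Exangulated.
Variables (C : additiveCat) (E : extBifunctor C) (k : nat).
Variable s : assignment E k.+1.
Hypothesis hC : is_exangulated s.
Implicit Types A B D V W : C.

Let hR := exang_real hC.

Lemma distinguished_ex A D (d : E D A) : exists X, s d X.
Proof.
by have [X cX e] := real_class hR d; exists X; rewrite e; exact: hclass_refl.
Qed.

(* Apply (EA2) to the first inclusion X_{n+1} -> X_{n+1} + W and the extension
   [d, x]: the cone realizes the zero extension, so its last arrow splits. *)
Lemma distinguished_push A D (d : E D A) Z W (x : E W A) :
  s d Z -> push (first_arr Z) x = 0 -> exists g : hom W D, x = pull g d.
Proof.
move=> sZ ex; pose z : E (D ⊕ W) A := pull pr1 d + pull pr2 x.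
have e1 : pull in1 z = d.
  by rewrite raddfD /= -!pull_comp pr1_in1 pr2_in1 pull_id pull0l addr0.
have e2 : pull in2 z = x.
  by rewrite raddfD /= -!pull_comp pr1_in2 pr2_in2 pull_id pull0l add0r.
have [U sU] := distinguished_ex z.
have sZ' : s (pull in1 z) Z by rewrite e1.
have [f [hf sK]] := exang_EA2 hC sZ' sU.
have dz : push (first_arr Z) z = 0.
  rewrite raddfD /= !push_pull ex (exangle_push (real_R1 hR sZ)) !raddf0.
  exact: addr0.
have [t et] : exists t, last_arr (cone f in1) ∘ t = idm (D ⊕ W).
  by apply/(exangle_cov (real_R1 hR sK) (D ⊕ W)).2; rewrite pull_id.
have [u [v euv]] := last_cone t; rewrite et in euv.
exists (u ∘ in2).
rewrite -e2 -[pull in2 z](pull_id) -pull_comp -[in2 ∘ _]comp1m.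
rewrite euv compDl pullD compm1 -!compA !pull_comp e1.
by rewrite (exangle_pull (real_R1 hR sU)) !raddf0 addr0.
Qed.

(** Dual argument: (EA2op) for the projection [pr1] gives a cocone realizing zero, so its first
    arrow [[arr U; pr1]] has a retraction [t]. As [arr U] kills [z], this writes [z] as a
    pushforward of [d]. *)
Lemma distinguished_pull A B D (d : E D A) Z (x : E D B) :
  s d Z -> pull (last_arr Z) x = 0 -> exists g : hom A B, x = push g d.
Proof.
move=> sZ ex; pose z : E D (A ⊕ B) := push in1 d + push in2 x.
have e1 : push pr1 z = d.
  by rewrite raddfD /= -!push_comp pr1_in1 pr1_in2 push_id push0l addr0.
have e2 : push pr2 z = x.
  by rewrite raddfD /= -!push_comp pr2_in1 pr2_in2 push_id push0l add0r.
have [U sU] := distinguished_ex z.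
have sZ' : s (push pr1 z) Z by rewrite e1.
have [f [hf sK]] := exang_EA2op hC sU sZ'.
have dz : pull (last_arr Z) z = 0.
  rewrite raddfD /= -!push_pull ex (exangle_pull (real_R1 hR sZ)) !raddf0.
  exact: addr0.
have [t et] : exists t, t ∘ first_arr (cocone pr1 f) = idm (A ⊕ B).
  by apply/(exangle_contra (real_R1 hR sK) (A ⊕ B)).2; rewrite push_id.
have ez : z = push (t ∘ in2) d.
  have hU : push (arr U) z = 0 := exangle_push (real_R1 hR sU).
  rewrite -[LHS]push_id -et /= /colm compDr pushD !push_comp.
  by rewrite hU !raddf0 add0r e1.
by exists (pr2 ∘ (t ∘ in2)); rewrite push_comp -ez e2.
Qed.

Lemma ext_injective J D (x : E D J) : is_injective s J -> x = 0.
Proof.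
move=> hJ; have [X sX] := distinguished_ex x.
have [h e] := hJ _ _ _ _ sX (idm J).
by rewrite -[x]push_id e push_comp (exangle_push (real_R1 hR sX)) raddf0.
Qed.

Lemma ext_projective P A (x : E P A) : is_projective s P -> x = 0.
Proof.
move=> hP; have [X sX] := distinguished_ex x.
have [h e] := hP _ _ _ _ sX (idm P).
by rewrite -[x]pull_id e pull_comp (exangle_pull (real_R1 hR sX)) raddf0.
Qed.

End Exangulated.

Section StableExtensions.
Variables (C : additiveCat) (E : extBifunctor C) (k : nat).
Variable s : assignment E k.+1.
Hypotheses (hC : is_exangulated s) (hF : is_frobenius s).
Implicit Types A B D V W : C.

Let hR := exang_real hC.
Local Notation st := (stabilize s).
Local Notation stm := (fmap (stabilize s)).

Lemma stab_repr A B (f : @hom (stableCat s) A B) :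
  exists g : hom A B, f = stm g.
Proof. by exists (repr f); rewrite /= qpi_repr. Qed.

Lemma stabD A B (f g : hom A B) : stm (f + g) = stm f + stm g.
Proof. exact: qpiD. Qed.

Lemma stab0 A B : stm (0 : hom A B) = 0.
Proof. exact: qpi0. Qed.

Lemma stabN A B (f : hom A B) : stm (- f) = - stm f.
Proof. by apply: (addrI (stm f)); rewrite -stabD !subrr stab0. Qed.

Lemma stab_comp A B D (g : hom B D) (f : hom A B) :
  stm (g ∘ f) = stm g ∘ stm f.
Proof. exact: qpi_comp. Qed.

Lemma stab_eq0 A B (f : hom A B) :
  stm f = 0 <->
  exists J (v : hom J B) (u : hom A J), is_injective s J /\ f = v ∘ u.
Proof.
rewrite -(stab0 A B); split=> [/qpiP/asboolP|[J [v [u [hJ e]]]]].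
  by rewrite subr0.
by apply/qpiP/asboolP; exists J, v, u; rewrite subr0.
Qed.

Lemma stable_push_pi A B D (a : hom A B) (d : E D A) :
  push (repr (stm a)) d = push a d.
Proof.
have /qpiP/asboolP[J [v [u [hJ e]]]] := qpi_repr (stm a).
rewrite -[repr _](subrK a) pushD e push_comp (ext_injective hC (push u d) hJ).
by rewrite raddf0 add0r.
Qed.

Lemma stable_pullE A B D (c : hom D B) (d : E B A) :
  pull (repr (stm c)) d = pull c d.
Proof. exact: stable_pull_pi c d hR hF. Qed.

Lemma stable_pushD A B D (a a' : qhom (injectives s) A B) (d : E D A) :
  push (repr (a + a')) d = push (repr a) d + push (repr a') d.
Proof. by rewrite -pushD -[in RHS]stable_push_pi /= qpiD !qpi_repr. Qed.

Lemma stable_pullD A B D (a a' : qhom (injectives s) B D) (d : E D A) :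
  pull (repr (a + a')) d = pull (repr a) d + pull (repr a') d.
Proof. by rewrite -pullD -[in RHS]stable_pullE /= qpiD !qpi_repr. Qed.

(** Stable morphisms act through representatives. The stable composite unfolds to the class of a
    composite of representatives, so each functor law is independence of the representative followed
    by the law for [E]. *)
Definition stableExt : extBifunctor (stableCat s) :=
  @ExtBifunctor (stableCat s) (fun D A => E D A)
    (fun D A A' a => push (repr a)) (fun D D' A c => pull (repr c))
    (fun D A d => etrans (stable_push_pi (@idm C A) d) (push_id d))
    (fun D A d => etrans (stable_pullE (@idm C D) d) (pull_id d))
    (fun D A A' A'' b a d =>
       etrans (stable_push_pi (@compose C A A' A'' (repr b) (repr a)) d)
              (push_comp (repr b) (repr a) d))
    (fun D D' D'' A c b d =>
       etrans (stable_pullE (@compose C D'' D' D (repr c) (repr b)) d)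
              (pull_comp (repr c) (repr b) d))
    (fun D D' A A' a c d => push_pull (repr a) (repr c) d)
    (fun D A A' a a' d => stable_pushD a a' d)
    (fun D D' A c c' d => stable_pullD c c' d).

Lemma stab_colm A B D (f : hom A B) (g : hom A D) :
  stm (colm f g) = colm (stm f) (stm g).
Proof. by rewrite /colm stabD !stab_comp. Qed.

Lemma stab_rowm A B D (f : hom A D) (g : hom B D) :
  stm (rowm f g) = rowm (stm f) (stm g).
Proof. by rewrite /rowm stabD !stab_comp. Qed.

Lemma stab_blockm A B D F (x : hom A D) (y : hom B D) (z : hom A F)
  (w : hom B F) :
  stm (blockm x y z w) = blockm (stm x) (stm y) (stm z) (stm w).
Proof. by rewrite /blockm stab_colm !stab_rowm. Qed.

Fixpoint map_cmap m A B A' B' : forall (X : chain m A B) (Y : chain m A' B'),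
    cmap X Y -> cmap (map_chain st X) (map_chain st Y) :=
  match m with
  | 0%N => fun _ _ _ => tt
  | m'.+1 => fun X Y f => (stm f.1, map_cmap f.2)
  end.

Lemma is_cmap_map m A B A' B' (X : chain m A B) (Y : chain m A' B')
    (a : hom A A') (f : cmap X Y) (b : hom B B') :
  is_cmap a f b -> is_cmap (stm a) (map_cmap f) (stm b).
Proof.
elim: m A A' X Y a f => [|m IH] A A' X Y a f /=.
  by move=> e; rewrite -!qpi_comp e.
by move=> [e h]; split; [rewrite -!qpi_comp e | exact: IH].
Qed.

Lemma first_map m A B (X : chain m A B) V (x : hom V A) :
  first_arr (map_chain st X) ∘ stm x = 0 <-> stm (first_arr X ∘ x) = 0.
Proof. by rewrite stab_comp; case: m X. Qed.

Lemma is_complex_map m A B (X : chain m A B) :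
  is_complex X -> is_complex (map_chain st X).
Proof.
elim: m A X => [|m IH] A X //= [e cX]; split; last exact: IH.
by apply/first_map; rewrite e stab0.
Qed.

Lemma map_last m A B (X : chain m A B) V (x : hom V (source X)) :
  exists y : @hom (stableCat s) V (source (map_chain st X)),
    last_arr (map_chain st X) ∘ y = stm (last_arr X ∘ x).
Proof.
elim: m A X x => [|m IH] A X x /=; last exact: IH.
by exists (stm x); exact: esym (qpi_comp _ X x).
Qed.

Lemma last_map m A B (X : chain m A B) :
  exists y : @hom (stableCat s) (source (map_chain st X)) (source X),
    last_arr (map_chain st X) = stm (last_arr X) ∘ y.
Proof.
elim: m A X => [|m IH] A X /=; last exact: IH.
  exists (@idm (stableCat s) A).
  exact: esym (@compm1 (stableCat s) _ _ (stm X)).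
Qed.

(** The length is a successor so that the target of the image chain is convertible to that of [X],
    without which the two sides would not have the same type. *)
Lemma map_cone_from m A B D F G (X : chain m.+1 A D) (Y : chain m.+1 B F)
    (f : cmap X Y) (l : forall V, hom V F -> hom (D ⊕ V) G)
    (l' : forall V : stableCat s, hom V (st F) -> hom (st D ⊕ V) (st G)) :
  (forall V d, stm (l V d) = l' (st V) (stm d)) ->
  map_chain st (cone_from f l) = cone_from (map_cmap f) l'.
Proof.
move=> e; elim: m A B X Y f => [|m IH] A B X Y f.
  have := e _ (tail Y); rewrite /= => ->; congr Step.
  by rewrite -[LHS]/(stm _) stab_blockm stabN stab0.
have := IH _ _ (tail X) (tail Y) f.2 => eI.
rewrite [LHS]/= [RHS]/=; congr Step; last exact: eI.
by rewrite -[LHS]/(stm _) stab_blockm stabN stab0.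
Qed.

Lemma map_cone m A D F (X : chain m.+1 A D) (Y : chain m.+1 A F)
    (f : cmap X Y) (c : hom D F) :
  map_chain st (cone f c) = cone (map_cmap f) (stm c).
Proof.
case: m X Y f => [|m] X Y f.
  rewrite [LHS]/= [RHS]/=; congr Step; last exact: stab_rowm.
  by rewrite -[LHS]/(stm _) stab_colm stabN.
have := map_cone_from f.2 (l := fun V d => rowm c d)
  (l' := fun (V : stableCat s) d => rowm (stm c) d) => eI.
rewrite [LHS]/= [RHS]/=; congr Step; last first.
  by apply: eI => V d; exact: stab_rowm.
by rewrite -[LHS]/(stm _) stab_colm stabN.
Qed.

End StableExtensions.

(** * Realization and shift on the stable category *)

Section StableRealization.
Variables (C : additiveCat) (E : extBifunctor C) (k : nat).
Variable s : assignment E k.+1.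
Hypotheses (hC : is_exangulated s) (hF : is_frobenius s).
Implicit Types A B D V W : C.

Let hR := exang_real hC.
Local Notation st := (stabilize s).
Local Notation stm := (fmap (stabilize s)).

(* The source of the image of Y is only provably equal to the source of Y, hence
   the dependent pairs. *)
Lemma map_cocone_from m A B D V (X : chain m A D) (Y : chain m B D)
    (f : cmap X Y) (u : hom A B) (d : hom V B) :
  existT (fun Z : stableCat s => (hom Z (st D) * chain m (st (A ⊕ V)) Z)%type)
    (source (map_chain st Y))
    (last_arr (map_chain st Y), cocone_from (map_cmap s f) (stm u) (stm d)) =
  existT _ (st (source Y)) (stm (last_arr Y), map_chain st (cocone_from f u d)).
Proof.
elim: m A B V X Y f u d => [|m IH] A B V X Y f u d.
  by rewrite /= -[qpi _ (rowm _ _)]/(stm _) stab_rowm stabN.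
pose G (t : {Z : stableCat s & (hom Z (st D) *
    chain m (st (obj X ⊕ B)) Z)%type}) :=
  existT (fun Z : stableCat s =>
      (hom Z (st D) * chain m.+1 (st (A ⊕ V)) Z)%type) (projT1 t)
    ((projT2 t).1, Step (st (obj X ⊕ B))
      (stm (blockm (arr X) 0 u (- d))) (projT2 t).2).
apply: etrans _ (congr1 G (IH _ _ _ (tail X) (tail Y) f.2 f.1 (arr Y))).
by rewrite {}/G stab_blockm stab0 stabN.
Qed.

Lemma map_cocone A B D (X : chain k.+1 A D) (Y : chain k.+1 B D)
    (f : cmap X Y) (u : hom A B) :
  existT (fun Z : stableCat s => (hom Z (st D) * chain k.+1 (st A) Z)%type)
    (source (map_chain st Y))
    (last_arr (map_chain st Y), cocone (stm u) (map_cmap s f)) =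
  existT _ (st (source Y)) (stm (last_arr Y), map_chain st (cocone u f)).
Proof.
pose G (t : {Z : stableCat s & (hom Z (st D) *
    chain k (st (obj X ⊕ B)) Z)%type}) :=
  existT (fun Z : stableCat s =>
      (hom Z (st D) * chain k.+1 (st A) Z)%type) (projT1 t)
    ((projT2 t).1, Step (st (obj X ⊕ B)) (stm (colm (arr X) u)) (projT2 t).2).
apply: etrans _ (congr1 G (map_cocone_from f.2 f.1 (arr Y))).
by rewrite {}/G stab_colm.
Qed.

(* A morphism W -> X_i whose composite with d_i is stably trivial lifts to a
   chain map from the injective resolution of W to the rest of X; its last
   component factors through d_n because the terms of the resolution are also
   projective, which gives a homotopy. *)
Lemma stable_lift m m' A D V W (X : chain m A D) (I : chain m'.+1 W V)
    (f : hom W A) (v : hom (obj I) (target X)) :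
  (m <= m')%N -> is_complex I -> (forall V', contra_exact V' I) ->
  all_mid (is_injective s) I -> (forall V', cov_exact V' X) ->
  (forall J (u : hom J D), is_injective s J -> exists t, u = last_arr X ∘ t) ->
  first_arr X ∘ f = v ∘ arr I ->
  exists t : hom (obj I) A, first_arr X ∘ (f - t ∘ arr I) = 0.
Proof.
elim: m m' A W X I f v => [|m IH] m' A W X I f v lm cI xI jI eX lX e.
  have [t et] := lX _ v jI.1; exists t.
  by rewrite compBr compA e et subrr.
case: m' I v lm cI xI jI e => [|m'] I v //= lm [dI cI] xI [j1 jI] e.
have [v2 ev2] : exists v2 : hom (obj (tail I)) (target (tail X)),
    v2 ∘ arr (tail I) = first_arr (tail X) ∘ v.
  by apply/(xI _).1; rewrite -compA -e; apply/(eX W).1; exists f.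
have [t2 e2] := IH m' _ _ (tail X) (tail I) v v2 lm cI (fun V' => (xI V').2) jI
  (fun V' => (eX V').2) lX (esym ev2).
have [t et] := ((eX _).1 _).1 e2.
exists t; rewrite compBr e compA et compBl -compA dI compm0 subr0.
exact: subrr.
Qed.

Lemma all_mid_source (P : C -> Prop) m A D (X : chain m.+1 A D) :
  all_mid P X -> P (source X).
Proof. by elim: m A X => [|m IH] A X; case=> // h; apply: IH. Qed.

Variable e : forall A : C, Iexangle s A.

(** A composite through an injective factors through the first term of the resolution of [W];
    [stable_lift] then corrects [f] by a stably zero morphism to an honest cycle. The bound on [m]
    ensures that the resolution is long enough. *)
Lemma map_cov_exact m A D W (X : chain m A D) :
  (m <= k.+1)%N -> is_complex X -> (forall V', cov_exact V' X) ->
  (forall J (u : hom J D), is_injective s J -> exists t, u = last_arr X ∘ t) ->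
  cov_exact (W : stableCat s) (map_chain st X).
Proof.
elim: m A X => [|m IH] A X // lm [dX cX] eX lX.
split; last by apply: IH lX => [||V']; [exact: ltnW | | exact: (eX V').2].
move=> v; split=> [|[w <-]]; last first.
  rewrite compA; have [w' ->] := stab_repr w.
  have -> : first_arr (map_chain st (tail X)) ∘ stm (arr X) = 0.
    by apply/first_map; rewrite dX stab0.
  by rewrite comp0m.
have [f ->] := stab_repr v; move=> /first_map/stab_eq0[J [u1 [u2 [hJ ef]]]].
have [g eg] := (Iex_left (e W)).2 _ u2 hJ.
pose I := Iex_seq (e W).
have hI := real_R1 hR (Iex_dist (e W)).
have [|t et] := stable_lift (I := I) (f := f) (v := u1 ∘ g) lm
  (exangle_complex hI) (fun V' => (exangle_contra hI V').1) (Iex_inj (e W))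
  (fun V' => (eX V').2) lX.
  by rewrite ef eg compA.
have [w ew] := ((eX W).1 _).1 et.
exists (stm w); change (stm (arr X) ∘ stm w = stm f); rewrite -stab_comp.
have -> : f = arr X ∘ w + t ∘ arr I by rewrite ew subrK.
rewrite stabD; apply/eqP; rewrite eq_sym addrC -subr_eq0 addrK; apply/eqP.
apply/stab_eq0; exists (obj I), t, (arr I); split=> //.
exact: (Iex_inj (e W)).1.
Qed.

Lemma map_covangle A D (d : E D A) (X : chain k.+1 A D) :
  s d X ->
  is_covangle (E := stableExt hC hF) (map_chain st X : chain k.+1 (st A) (st D))
    d.
Proof.
move=> sX; have hX := real_R1 hR sX.
have lX J (u : hom J D) : is_injective s J -> exists t, u = last_arr X ∘ t.
  by move=> /(frob_eq hF) hJ; exact: hJ sX u.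
split.
- exact: is_complex_map (exangle_complex hX).
- rewrite /= stable_push_pi //; exact: exangle_push hX.
- have [y ->] := last_map s X.
  rewrite pull_comp /= stable_pullE // (exangle_pull hX); exact: raddf0.
- move=> W; apply: map_cov_exact lX => //; first exact: exangle_complex hX.
  by move=> V; exact: (exangle_cov hX V).1.
- move=> W y; have [y' ->] := stab_repr y; rewrite /= stable_pullE //.
  move=> /(exangle_cov hX W).2[g <-].
  by have [g' eg'] := map_last s g; exists g'; exact: esym eg'.
Qed.

Lemma map_push A D (d : E D A) (X : chain k.+1 A D) (W : C) (x : E W A) :
  s d X -> @push _ (stableExt hC hF) _ _ _ (stm (arr X)) x = 0 ->
  exists g, x = @pull _ (stableExt hC hF) _ _ _ g d.
Proof.
move=> sX; rewrite /= stable_push_pi // => /(distinguished_push hC sX)[g ->].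
by exists (stm g); rewrite /= stable_pullE.
Qed.

Lemma map_first m A B (X : chain m A B) V (w : hom (target X) V) :
  exists h, stm (w ∘ first_arr X) = h ∘ first_arr (map_chain st X).
Proof. by rewrite stab_comp; case: m X w => [|m] X w; exists (stm w). Qed.

(** If [g ∘ arr X] is [u1 ∘ u2] through an injective, [u2] extends along [arr X] to [t], and
    [g - u1 ∘ t], which has the same stable class as [g], is killed by [arr X]. *)
Lemma map_contra A D (d : E D A) (X : chain k.+1 A D) (W : C)
    (g : hom (obj X) W) :
  s d X -> stm (g ∘ arr X) = 0 ->
  exists h, stm g = h ∘ first_arr (map_chain st (tail X)).
Proof.
move=> sX /stab_eq0[J [u1 [u2 [hJ ef]]]]; have hX := real_R1 hR sX.
have [t et] := hJ _ _ _ _ sX u2.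
have [|w ew] := ((exangle_contra hX W).1.1 (g - u1 ∘ t)).1.
  by rewrite compBl ef et -compA subrr.
have -> : stm g = stm (w ∘ first_arr (tail X)).
  rewrite ew stabD stabN (_ : stm (u1 ∘ t) = 0) ?subr0 //.
  by apply/stab_eq0; exists J, u1, t.
exact: map_first.
Qed.

Lemma stable_class_cmaps A D (d : E D A) (X : chain k.+1 A D)
    (Z : @chain (stableCat s) k.+1 A D) :
  s d X -> is_complex Z -> (forall V : stableCat s, cov_exact V Z) ->
  (exists f : cmap (map_chain st X) Z,
     is_cmap (@idm (stableCat s) A) f (@idm (stableCat s) D)) ->
  (exists f : cmap Z (map_chain st X),
     is_cmap (@idm (stableCat s) A) f (@idm (stableCat s) D)) ->
  stable_class d Z.
Proof.
move=> sX cZ eZ [f hf] [g hg]; exists X => //; split=> //.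
have hX := map_covangle sX.
exact: homotopy_equivalentP (cov_complex hX) cZ (cov_mid hX) eZ hf hg.
Qed.

Lemma stable_class_map A D (d : E D A) (X : chain k.+1 A D) :
  s d X -> stable_class d (map_chain st X).
Proof.
move=> sX; exists X => //; apply: hclass_refl.
exact: is_complex_map (exangle_complex (real_R1 hR sX)).
Qed.

Lemma map_zero_chain m A D :
  map_chain st (zero_chain m A D) = @zero_chain (stableCat s) m A D.
Proof.
elim: m A => [|m IH] A; first exact: stab0.
rewrite [LHS]/= [RHS]/=; congr Step; [exact: stab0 | exact: IH].
Qed.

Lemma stable_class_id_left A :
  stable_class (0 : E zob A) (@id_left (stableCat s) k.+1 A).
Proof.
have cX m B : is_complex (@zero_chain C m B zob).
  elim: m B => [|m IH] B //; split; last exact: IH.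
  exact: compm0.
have f0 m B D : first_arr (@zero_chain C m B D) = 0 by case: m.
have <- : map_chain st (id_left k.+1 A) = @id_left (stableCat s) k.+1 A.
  by rewrite [LHS]/= [RHS]/=; congr Step; exact: map_zero_chain.
apply: stable_class_map; rewrite (real_R2l hR); apply: hclass_refl; split=> //.
exact: etrans (compm1 _) (f0 _ _ _).
Qed.

Lemma stable_realization :
  is_cov_realization (E := stableExt hC hF)
    (fun D A (d : E D A) => stable_class d).
Proof.
split.
- move=> A D d; have [X sX] := distinguished_ex hC d.
  by exists (map_chain st X); exact: stable_class_map.
- move=> A B D F d r Z Z' a c [X sX [_ [_ [q [_ hq _ _]]]]].
  move=> [Y sY [_ [p [_ [hp _ _ _]]]]] er.
  have [f hf] := real_R0 hR sX sY er.
  have := is_cmap_comp (is_cmap_comp hq (is_cmap_map s hf)) hp.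
  rewrite !(@comp1m (stableCat s)) !(@compm1 (stableCat s)).
  rewrite (qpi_repr a : stm (repr a) = a) (qpi_repr c : stm (repr c) = c) => h.
  by exists (cmap_comp p (cmap_comp (map_cmap s f) q)).
- move=> A D d Z [X sX [cZ [p [q [hp hq _ H]]]]].
  have hX := map_covangle sX; split=> //.
  + rewrite -[first_arr Z]compm1 -(cmap_firstP hp) push_comp (cov_push hX).
    exact: raddf0.
  + have [y ey] := is_cmap_last hq.
    rewrite -[last_arr Z]comp1m -ey pull_comp (cov_pull hX); exact: raddf0.
  + move=> W; apply: (cov_exact_homotopic (e := 0) cZ hp hq _ (cov_mid hX W)).
    rewrite !(@comp1m (stableCat s)); exact: H.
  + move=> W y /(cov_right hX)[g ->]; have [y' ey'] := is_cmap_last hp.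
    by exists (y' ∘ g); rewrite compA ey' comp1m.
- move=> A D d Z [X sX [cZ [p [q [hp hq _ H]]]]] W x ex.
  apply: map_push sX _.
  change (@push _ (stableExt hC hF) _ _ _ (first_arr (map_chain st X)) x = 0).
  rewrite -[first_arr _]compm1 -(cmap_firstP hq) push_comp ex.
  exact: raddf0.
- move=> A D d Z [X sX [cZ [p [q [hp hq _ H]]]]] W g eg.
  have [h eh] : exists h, g ∘ p.1 = h ∘ first_arr (map_chain st (tail X)).
    have [g' eg'] := stab_repr (g ∘ p.1).
    rewrite eg'; apply: map_contra sX _.
    rewrite stab_comp -eg' -(@compA (stableCat s)) hp.1 compA eg comp0m //.
  (* At the first middle term the homotopy reads [p q - 1 = d_0 phi + phi2 d_1]; composing with [g],
     which kills [d_0], expresses [g] through [d_1]. *)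
  have [phi [_ /homotopic_from_first[phi2 e2]]] := H.
  exists (h ∘ cmap_first q.2 (@idm (stableCat s) D) - g ∘ phi2).
  rewrite compBl -compA (cmap_firstP hq.2) compA -eh -compA -compA.
  have : g ∘ (p.1 ∘ q.1 - idm (obj Z)) =
      g ∘ (arr Z ∘ phi + phi2 ∘ first_arr (tail Z)) by rewrite -e2.
  rewrite compBr compm1 compDr !(compA g) eg comp0m add0r.
  by move=> <-; rewrite opprB addrC subrK.
- move=> A D d W Z cZ eZ [X sX [_ [p [q [hp hq _ _]]]]] [f hf] [g hg].
  apply: stable_class_cmaps sX cZ eZ _ _.
    by exists (cmap_comp g p); have := is_cmap_comp hp hg; rewrite !comp1m.
  by exists (cmap_comp q f); have := is_cmap_comp hf hq; rewrite !comp1m.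
- exact: stable_class_id_left.
- move=> A B D r c.
  have [X sX] := distinguished_ex hC (pull (repr c) r).
  have [Y sY] := distinguished_ex hC r.
  have [f [hf sK]] := exang_EA2 hC sX sY.
  exists (map_chain st X), (map_chain st Y), (map_cmap s f); split.
  + exact: stable_class_map.
  + exact: stable_class_map.
  + have := is_cmap_map s hf; rewrite (qpi_repr c : stm (repr c) = c).
    exact.
  + have := stable_class_map sK; rewrite map_cone.
    rewrite (qpi_repr c : stm (repr c) = c) /= stable_push_pi //; exact.
- move=> A B D d a.
  have [X sX] := distinguished_ex hC d.
  have [Y sY] := distinguished_ex hC (push (repr a) d).
  have [f [hf sK]] := exang_EA2op hC sX sY.
  have ea : stm (repr a) = a := qpi_repr a.
  exists (map_chain st X), (map_chain st Y), (map_cmap s f); split.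
  + exact: stable_class_map.
  + exact: stable_class_map.
  + by have := is_cmap_map s hf; rewrite ea; exact.
  (* As a property of dependent pairs, [Q] can be transported along [map_cocone] although the two
     sources are not convertible. *)
  + pose Q (t : {Z : stableCat s &
        (hom Z (st D) * chain k.+1 (st A) Z)%type}) :=
      @stable_class C E k.+1 s (projT1 t) A
        (@pull _ (stableExt hC hF) _ _ _ (projT2 t).1 d) (projT2 t).2.
    have : Q (existT _ (st (source Y)) (stm (last_arr Y),
        map_chain st (cocone (repr a) f))).
      change (@stable_class C E k.+1 s (source Y) A
        (pull (repr (stm (last_arr Y))) d) (map_chain st (cocone (repr a) f))).
      by rewrite stable_pullE //; exact: stable_class_map sK.
    by rewrite -map_cocone ea.
Qed.

Lemma stable_shift :
  is_shift (E := stableExt hC hF) (S := S_functor e)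
    (fun A : stableCat s => Iex_ext (e A)).
Proof.
have sI A : s (Iex_ext (e A)) (Iex_seq (e A)) := Iex_dist (e A).
have jl A : is_injective s (target (Iex_seq (e A))) := (Iex_left (e A)).1.
have jr A : is_injective s (source (Iex_seq (e A))) := (Iex_right (e A)).1.
have surj A D (d : E D A) : exists h, d = pull h (Iex_ext (e A)).
  have e0 : push (first_arr (Iex_seq (e A))) d = 0 :=
    ext_injective hC _ (jl A).
  exact: (distinguished_push hC (sI A) e0).
have inj A D (h : hom D (Iex_S (e A))) : pull h (Iex_ext (e A)) = 0 ->
    stm h = 0.
  move=> /(exangle_cov (real_R1 hR (sI A)) D).2[g <-].
  apply/stab_eq0.
  by exists (source (Iex_seq (e A))), (last_arr (Iex_seq (e A))), g.
split.
- move=> A B f; rewrite /= /S_map.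
  set P := [set _ | _]%classic.
  (* The set is inhabited, so [xget] returns one of its members and not the default 0. *)
  have : P (xget 0 P).
    apply: (@xgetPex _ 0 P).
    have [g eg] := surj _ _ (push (repr f) (Iex_ext (e A))).
    exists (stm g), (repr f), g; split=> //; exact: esym (qpi_repr f).
  move=> [f' [g' [-> -> e']]].
  by rewrite stable_push_pi // stable_pullE.
- move=> A D h; have [h' ->] := stab_repr h.
  by rewrite /= stable_pullE //; exact: inj.
- move=> A D d; have [h ->] := surj _ _ d.
  by exists (stm h); rewrite /= stable_pullE.
- move=> A B f; have [f' ->] := stab_repr f; rewrite /= stable_push_pi //.
  move=> /(exangle_contra (real_R1 hR (sI A)) B).2[g <-].
  apply/stab_eq0.
  by exists (target (Iex_seq (e A))), g, (first_arr (Iex_seq (e A))).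
(* The last middle term for [A] is injective, hence projective, so every extension becomes zero when
   pulled back to it. *)
- move=> A B d; have [|g ->] := distinguished_pull hC (x := d) (sI A).
    by apply: (ext_projective hC); apply/(frob_eq hF); exact: jr.
  by exists (stm g); rewrite /= stable_push_pi.
(* An exangle from [B] through projectives to [D] plays the role of the chosen one for [B]: [d] and
   the extension of [B] are pullbacks of each other along [u] and [v]. The composites preserve these
   extensions, so they differ from identities by morphisms through injectives. *)
- move=> D; have [B [d [X [sX hX]]]] := frob_proj hF D.
  have [u eu] := surj _ _ d.
  have [v ev] : exists v, Iex_ext (e B) = pull v d.
    have e0 : push (first_arr X) (Iex_ext (e B)) = 0.
      by apply: (ext_injective hC); apply/(frob_eq hF); exact: hX.1.
    exact: (distinguished_push hC sX e0).
  have eqm A (f g : hom A A) : stm (f - g) = 0 -> stm f = stm g.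
    by rewrite stabD stabN => /eqP; rewrite subr_eq0 => /eqP.
  exists B, (stm u), (stm v); split.
    rewrite -stab_comp; apply: (eqm _ _ (@idm C D)).
    have : pull (v ∘ u - @idm C D) d = 0.
      by rewrite pullD pullNl pull_id pull_comp -ev -eu subrr.
    move=> /(exangle_cov (real_R1 hR sX) D).2[g <-].
    apply/stab_eq0; exists (source X), (last_arr X), g; split=> //.
    by apply/(frob_eq hF); exact: all_mid_source hX.
  rewrite -stab_comp; apply: (eqm _ _ (@idm C _)); apply: inj.
  by rewrite pullD pullNl pull_id pull_comp -eu -ev subrr.
Qed.

End StableRealization.

Theorem theorem1p1 (n : nat) (hn : (0 < n)%N)
  (C : additiveCat) (E : extBifunctor C) (s : assignment E n)
  (hC : is_exangulated s) (hF : is_frobenius s)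
  (e : forall X : C, Iexangle s X) :
  is_angulated n (stableCat s) (S_functor e) (S_sequences e).
Proof.
case: n hn s hC hF e => // k _ s hC hF e.
exact: (shift_angulated (stable_realization hC hF e) (stable_shift hC hF e)).
Qed.
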